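(* Let $P$ be a spiral on $n$ nodes with $k=O(\log n)$ turning points $(tp_1,\dots,tp_k)$, $tp_1$ being the internal and $tp_k$ the external endpoint. Then in the connectivity graph model $P$ can be grown from a single node placed at $tp_k$ in $O(\log n)$ time steps.
   Context: Shapes. Grid points are integer pairs $(x,y)$; two grid points are adjacent if they are at orthogonal (Manhattan) distance $1$. A shape $S=(V,E)$ is a finite connected graph whose nodes occupy distinct grid points and whose edges join only pairs of nodes occupying adjacent points; shapes are considered up to translation, and $n=|V|$. Growth operations. One node, the anchor $u_0$, is stationary; other nodes move relative to it, and a tree is rooted at $u_0$. A growth operation on a node $u$ toward an adjacent grid point $p$ either (i) if $u$ has no edge to $p$, creates a new node $u'$ at $p$ with edge $uu'$; or (ii) if $p$ is occupied by a node $v$ with $uv\in E$, creates a new node $u'$ at $p$, replaces edge $uv$ by edges $uu',u'v$, and translates by one unit, along the axis of $uv$, the part of the tree hanging from whichever of $u,v$ is farther from $u_0$, away from the other endpoint. In one time step a set of operations is applied concurrently, each node receiving at most one operation and all operations having the same cardinal direction; the displacement of each node is the sum of the unit vectors contributed by the operations on its path to $u_0$. The set is collision-free if no two nodes collide during these motions or end at the same point. Growth processes (connectivity graph model). A growth process from an initial shape $S_0$ performs time steps $t=1,2,\dots$, each applying a collision-free set of growth operations to the current shape; no edges are deleted and no edges are created other than by the operations. It grows $S$ from $S_0$ in $t_f$ time steps if the shape obtained after step $t_f$ is $S$. Paths and spirals. For a path $P=(u_1,\dots,u_n)$, $u_i$ is a turning point if $i\in\{1,n\}$ or $u_{i-1}u_i\perp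 u_iu_{i+1}$. A spiral is a path whose turning points, ordered from one endpoint to the other, follow consecutive cardinal directions in a single rotational sense (always clockwise or always counterclockwise). A single spiral winds outward without self-intersection from an internal endpoint $tp_1$ to an external endpoint $tp_k$; segment $s_i$ joins $tp_i$ and $tp_{i+1}$. *)

(* Defs.v *)
From HB Require Import structures.
From mathcomp Require Import all_boot all_order all_algebra.
From mathcomp Require Import finmap.
From mathcomp Require Import boolp.

Set Implicit Arguments.
Unset Strict Implicit.
Unset Printing Implicit Defensive.

Import Order.TTheory GRing.Theory Num.Theory.
Local Open Scope fset_scope.
Local Open Scope ring_scope.

Definition pt := (int * int)%type.
Definition pt0 : pt := (0, 0).
Definition padd (p q : pt) : pt := (p.1 + q.1, p.2 + q.2).
Definition psub (p q : pt) : pt := (p.1 - q.1, p.2 - q.2).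
Definition pscale (z : int) (p : pt) : pt := (z * p.1, z * p.2).

Definition adjacent (p q : pt) : bool := (`|p.1 - q.1|%N + `|p.2 - q.2|%N == 1)%N.

Definition cardinal_dirs : seq pt := [:: (1, 0); (-1, 0); (0, 1); (0, -1)].

(* Shapes (in the coordinates of the stationary anchor): node set and   *)
(* undirected edges, an edge being the 2-element set of its endpoints.  *)
(* Nodes occupy distinct grid points, so a node is identified with its  *)
(* current grid point.                                                  *)

Record shape := Shape { sV : {fset pt}; sE : {fset {fset pt}} }.

Definition edge (x y : pt) : {fset pt} := [fset x; y].

Inductive reach (E : {fset {fset pt}}) : pt -> pt -> Prop :=
| reach_refl x : reach E x x
| reach_step x y z : edge x y \in E -> reach E y z -> reach E x z.

(* w hangs below the edge e (w.r.t. the anchor a): removing e disconnects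
   w from the anchor, i.e. w is in the part of the tree hanging from the
   endpoint of e farther from the anchor. *)
Definition hangs (E : {fset {fset pt}}) (a : pt) (e : {fset pt}) (w : pt) : bool :=
  `[< ~ reach (E `\ e) w a >].

Section Step.
Variables (S : shape) (a d : pt) (U : {fset pt}).

(* operation on u toward p = u + d is of type (ii) iff uv is an edge, v = p *)
Definition splits (u : pt) : bool := edge u (padd u d) \in sE S.

(* unit contribution (as a multiple of d) of the operation on u to the
   displacement of node w: in case (ii) the part of the tree hanging from
   the farther endpoint of uv moves one unit along uv away from the other
   endpoint, i.e. by +d if v = u + d is the farther one, by -d if u is. *)
Definition contrib (u w : pt) : int :=
  if splits u && hangs (sE S) a (edge u (padd u d)) w then
    (if hangs (sE S) a (edge u (padd u d)) (padd u d) then 1 else -1)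
  else 0.

Definition disp (w : pt) : pt := pscale (\sum_(u <- U) contrib u w) d.

Definition fpos (w : pt) : pt := padd w (disp w).

(* final position of the node u' created by the operation on u: adjacent to
   the final position of u in direction d (between u and v in case (ii)) *)
Definition newpos (u : pt) : pt := padd (fpos u) d.

Definition traj (w : pt) (t : rat) : rat * rat :=
  ((w.1)%:~R + t * ((disp w).1)%:~R, (w.2)%:~R + t * ((disp w).2)%:~R).

Definition collision_free : Prop :=
  (forall w1 w2, w1 \in sV S -> w2 \in sV S -> w1 != w2 ->
     forall t : rat, 0 <= t <= 1 -> traj w1 t != traj w2 t)
  /\ (forall u w, u \in U -> w \in sV S -> newpos u != fpos w)
  /\ (forall u1 u2, u1 \in U -> u2 \in U -> u1 != u2 -> newpos u1 != newpos u2).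

Definition map_edge (e : {fset pt}) : {fset pt} := [fset fpos x | x in e].

Definition step_result : shape :=
  Shape ([fset fpos w | w in sV S] `|` [fset newpos u | u in U])
    ([fset map_edge e | e in sE S `\` [fset edge u (padd u d) | u in [fset u in U | splits u]]]
     `|` [fset edge (fpos u) (newpos u) | u in U]
     `|` [fset edge (newpos u) (fpos (padd u d)) | u in [fset u in U | splits u]]).

End Step.

Definition growth_step (a : pt) (S S' : shape) : Prop :=
  exists (d : pt) (U : {fset pt}),
    [/\ d \in cardinal_dirs, U `<=` sV S, collision_free S a d U &
        S' = step_result S a d U].

Inductive grows (a : pt) : nat -> shape -> shape -> Prop :=
| grows0 S : grows a 0 S S
| growsS t S1 S2 S3 : grows a t S1 S2 -> growth_step a S2 S3 -> grows a t.+1 S1 S3.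

Definition grid_path (s : seq pt) : bool :=
  if s is x :: s' then uniq s && path adjacent x s' else false.

Definition path_shape (s : seq pt) : shape :=
  Shape [fset x in s] [fset edge p.1 p.2 | p in zip s (behead s)].

(* direction of the edge u_(i+1) u_(i+2) (0-based: from nth i to nth i+1) *)
Definition pdir (s : seq pt) (i : nat) : pt := psub (nth pt0 s i.+1) (nth pt0 s i).

Definition perp (p q : pt) : bool := p.1 * q.1 + p.2 * q.2 == 0.

Definition turning (s : seq pt) (i : nat) : bool :=
  [|| i == 0%N, i == (size s).-1 | perp (pdir s i.-1) (pdir s i)].

Definition num_turning (s : seq pt) : nat := count (turning s) (iota 0 (size s)).

Definition rot_ccw (p : pt) : pt := (- p.2, p.1).
Definition rot_cw (p : pt) : pt := (p.2, - p.1).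

Definition spiral (s : seq pt) : Prop :=
  grid_path s /\
  exists rot, (rot = rot_ccw \/ rot = rot_cw) /\
    forall i, (0 < i)%N -> (i.+1 < size s)%N -> perp (pdir s i.-1) (pdir s i) ->
      pdir s i = rot (pdir s i.-1).

(* external endpoint: p lies on the outer boundary (bounding box) of s *)
Definition on_outer_boundary (s : seq pt) (p : pt) : bool :=
  [|| all (fun q => q.1 <= p.1) s, all (fun q => p.1 <= q.1) s,
      all (fun q => q.2 <= p.2) s | all (fun q => p.2 <= q.2) s].

(* Main.v *)
Require Import Defs.
From HB Require Import structures.
From mathcomp Require Import all_boot all_order all_algebra.
From mathcomp Require Import finmap.
From mathcomp Require Import boolp zify ring lra.

(** The path is listed from the anchor inwards and encoded by its segment
    lengths. Splitting edges of one axis lets every segment of that axis be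
    lengthened by any amount up to doubling. The lengths of the spirals in
    question satisfy a few strict linear inequalities, each relating segments
    of one axis only ([ok]); these inequalities force the nodes to be
    distinct for arbitrary positive edge lengths, and they are preserved by
    convex combinations, so no collision happens during the linear motion
    between two such spirals.

    One first grows the smallest spiral with the given number of segments, by
    adding one segment at a time at the inner end and lengthening the others by
    at most one. From the lengths [c] of that spiral, the target lengths [L] are
    reached through [c + (L - c) %/ 2 ^ k] for decreasing [k], which at most
    doubles every length at each stage and keeps the inequalities. *)

Set Implicit Arguments.
Unset Strict Implicit.
Unset Printing Implicit Defensive.
Import Order.TTheory GRing.Theory Num.Theory.

(** * Lattice walks given by their steps *)

Section Walks.
Variable V : zmodType.
Local Open Scope ring_scope.
Implicit Types (a e f x : V) (v w : seq V) (l : seq nat).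

Definition pts a v : seq V := a :: scanl +%R a v.

(** When [f] is [e] rotated by a quarter, passing from the frame [(e, f)] to [(f, - e)] repeats the
    same rotation, so every corner turns in one sense. *)
Fixpoint dirs e f l : seq V :=
  if l is n :: l' then nseq n e ++ dirs f (- e) l' else [::].

Lemma size_pts a v : size (pts a v) = (size v).+1.
Proof. by rewrite /= size_scanl. Qed.

Lemma scanl_shift a v : scanl +%R a v = [seq a + x | x <- scanl +%R 0 v].
Proof.
suff H b : scanl +%R (a + b) v = [seq a + x | x <- scanl +%R b v].
  by rewrite -H addr0.
by elim: v b => //= x v IH b; rewrite -addrA IH.
Qed.

Lemma uniq_pts_shift a v : uniq (pts a v) = uniq (pts 0 v).
Proof.
rewrite -(map_inj_uniq (addrI a) (pts 0 v)) /pts map_cons addr0.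
by rewrite scanl_shift.
Qed.

Lemma foldl_addE a v : foldl +%R a v = a + \sum_(x <- v) x.
Proof.
elim: v a => [|x v IH] a /=; first by rewrite big_nil addr0.
by rewrite IH big_cons addrA.
Qed.

Lemma pts_cat a v w :
  pts a (v ++ w) = pts a v ++ scanl +%R (a + \sum_(x <- v) x) w.
Proof. by rewrite /pts scanl_cat foldl_addE. Qed.

Lemma uniq_pts_cat a v w : uniq (pts a v) -> uniq (pts 0 w) ->
  (forall p q, p \in pts a v -> q \in scanl +%R 0 w ->
     p != (a + \sum_(x <- v) x) + q) ->
  uniq (pts a (v ++ w)).
Proof.
move=> U1; rewrite [uniq (pts 0 _)]cons_uniq => /andP[_ U2] H.
rewrite pts_cat cat_uniq U1 scanl_shift.
rewrite map_inj_uniq ?U2 ?andbT; last exact: addrI.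
apply/hasPn => _ /mapP[q Hq ->]; apply/negP => Hp.
by have /eqP := H _ _ Hp Hq.
Qed.

Lemma nth_pts x0 a v i : (i <= size v)%N ->
  nth x0 (pts a v) i = a + \sum_(x <- take i v) x.
Proof.
elim: v a i => [|x v IH] a [|i] //= Hi; rewrite ?big_nil ?addr0 //.
by have /= -> := IH (a + x) i Hi; rewrite big_cons addrA.
Qed.

Lemma last_pts x0 a v : last x0 (pts a v) = a + \sum_(x <- v) x.
Proof. by rewrite /= -foldl_addE; elim: v a => //= x v IH a. Qed.

Lemma dirs_cat e f l1 l2 : exists e' f',
  dirs e f (l1 ++ l2) = dirs e f l1 ++ dirs e' f' l2.
Proof.
elim: l1 e f => [|n l1 IH] e f; first by exists e, f.
by have [e' [f' H]] := IH f (- e); exists e', f'; rewrite /= H catA.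
Qed.

End Walks.

(** * Spirals with arbitrary positive edge lengths *)

Section WeightedSpiral.
Variable R : realFieldType.
Local Open Scope ring_scope.
Local Notation V := (R * R)%type.
Implicit Types (e f p : V) (w : seq R) (ws : seq (seq R)) (l : seq R).

Definition dot e p : R := e.1 * p.1 + e.2 * p.2.
Definition vscale (c : R) p : V := (c * p.1, c * p.2).
Definition orthobasis e f := [/\ dot e e = 1, dot f f = 1 & dot e f = 0].

(** Edge lengths are kept one by one, since during a step split and unsplit edges of one segment
    differ in length. *)
Fixpoint wdirs e f ws : seq V :=
  if ws is w :: ws' then [seq vscale c e | c <- w] ++ wdirs f (- e) ws' else [::].

Definition sums ws : seq R := [seq \sum_(c <- w) c | w <- ws].
Definition positive ws := all (all (fun c : R => 0 < c)) ws.

(** As [nth] is [0] past the end, the last two lengths are forced to be positive. *)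
Definition shrinking l :=
  forall i, (i < size l)%N -> nth 0 l i.+2 < nth 0 l i.

Lemma dotC e p : dot e p = dot p e.
Proof. rewrite /dot; ring. Qed.
Lemma dotDr e p q : dot e (p + q) = dot e p + dot e q.
Proof. by rewrite /dot /=; ring. Qed.
Lemma dotNl e p : dot (- e) p = - dot e p.
Proof. by rewrite /dot /=; ring. Qed.
Lemma dotZr e c p : dot e (vscale c p) = c * dot e p.
Proof. by rewrite /dot /=; ring. Qed.

Lemma orthobasis_rot e f : orthobasis e f -> orthobasis f (- e).
Proof.
case=> He Hf H; split=> //; first by rewrite dotNl dotC dotNl opprK.
by rewrite dotC dotNl H oppr0.
Qed.

Lemma shrinking_behead c l : shrinking (c :: l) -> shrinking l.
Proof. by move=> H i Hi; exact: (H i.+1). Qed.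

Lemma sum_vscale e w : \sum_(x <- [seq vscale c e | c <- w]) x = vscale (\sum_(c <- w) c) e.
Proof.
rewrite big_map; elim: w => [|c w IH]; rewrite ?big_nil ?big_cons.
  by rewrite /vscale !mul0r.
by rewrite IH /vscale !mulrDl.
Qed.

Lemma mem_segment e w p : all (fun c : R => 0 < c) w ->
  p \in scanl +%R 0 [seq vscale c e | c <- w] ->
  exists2 c, 0 < c <= \sum_(c <- w) c & p = vscale c e.
Proof.
elim: w p => [|c w IH] p //= /andP[c0 Hw].
have S0 : 0 <= \sum_(c <- w) c.
  by rewrite big_seq sumr_ge0 // => x /(allP Hw) /ltW.
rewrite add0r inE scanl_shift big_cons => /orP[/eqP->|/mapP[q Hq ->]].
  by exists c => //; rewrite c0 lerDl.
have [c' /andP[c'0 Hc'] ->] := IH _ Hw Hq.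
exists (c + c'); first by rewrite addr_gt0 // lerD2l.
by rewrite /vscale !mulrDl.
Qed.

Lemma uniq_segment e w : dot e e = 1 -> all (fun c : R => 0 < c) w ->
  uniq (pts 0 [seq vscale c e | c <- w]).
Proof.
move=> He; elim: w => [|c w IH] //= /andP[c0 Hw].
have Hcw : all (fun c : R => 0 < c) (c :: w) by rewrite /= c0.
apply/andP; split.
  apply/negP => /(mem_segment (w := c :: w) Hcw) [c' /andP[c'0 _] H].
  have := dotZr e c' e; rewrite -H He mulr1 /dot /= !mulr0 addr0 => H0.
  by rewrite -H0 ltxx in c'0.
by rewrite add0r; have /= -> := uniq_pts_shift (vscale c e) [seq vscale c e | c <- w]; exact: IH.
Qed.

Lemma sums_ge0 ws i : positive ws -> 0 <= nth 0 (sums ws) i.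
Proof.
move=> Hp; have [Hi|Hi] := ltnP i (size ws); last by rewrite nth_default // size_map.
rewrite (nth_map [::]) // big_seq sumr_ge0 // => x Hx.
by have /allP/(_ _ Hx)/ltW := allP Hp _ (mem_nth [::] Hi).
Qed.

(** Seen from the end of the first segment, the rest advances along [f] by at most the second length
    and goes back along [e] by at most the third, which is smaller than the first; so the coordinate
    along [e] stays positive. *)
Lemma shrinking_box e f ws p : orthobasis e f -> positive ws ->
  shrinking (sums ws) -> p \in scanl +%R 0 (wdirs e f ws) ->
  [/\ 0 < dot e p, dot e p <= nth 0 (sums ws) 0,
      0 <= dot f p & dot f p <= nth 0 (sums ws) 1].
Proof.
elim: ws e f p => [|w ws IH] e f p //= ef /andP[Hw Hp] Hs.
have [He Hf Hef] := ef.
have S1 := sums_ge0 0 Hp; have S2 := sums_ge0 1 Hp.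
rewrite scanl_cat mem_cat => /orP[].
  case/(mem_segment Hw) => c /andP[c0 Hc] ->.
  by rewrite !dotZr (dotC f) He Hef mulr1 mulr0.
rewrite foldl_addE add0r sum_vscale scanl_shift => /mapP[q Hq ->].
have [] := IH _ _ _ (orthobasis_rot ef) Hp (shrinking_behead Hs) Hq.
have := Hs 0%N isT.
rewrite !dotDr !dotZr (dotC f e) He Hef dotNl /=; move: S1 S2.
set l2 := nth _ _ _; set l3 := nth _ _ _; set l1 := \sum_(c <- w) c.
by move=> ? ? ? ? ? ? ?; split; lra.
Qed.

Lemma mem_pts_segment e w p : all (fun c : R => 0 < c) w ->
  p \in pts 0 [seq vscale c e | c <- w] ->
  exists2 c, 0 <= c <= \sum_(c <- w) c & p = vscale c e.
Proof.
move=> Hw; rewrite inE => /orP[/eqP->|/(mem_segment Hw)[c /andP[/ltW c0 Hc] ->]].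
  exists 0; last by rewrite /vscale !mul0r.
  by rewrite lexx big_seq sumr_ge0 // => x /(allP Hw) /ltW.
by exists c; rewrite ?c0.
Qed.

(** The first segment has coordinate [0] along [f], whereas [shrinking_box] makes this coordinate
    positive on everything after it. *)
Lemma uniq_shrinking e f ws : orthobasis e f -> positive ws ->
  shrinking (sums ws) -> uniq (pts 0 (wdirs e f ws)).
Proof.
elim: ws e f => [|w ws IH] e f //= ef /andP[Hw Hp] Hs.
have [He Hf Hef] := ef; have Hs' := shrinking_behead Hs.
apply: uniq_pts_cat; first exact: uniq_segment.
  exact: (IH _ _ (orthobasis_rot ef)).
move=> p q /(mem_pts_segment Hw)[c _ ->] Hq.
have [H _ _ _] := shrinking_box (orthobasis_rot ef) Hp Hs' Hq.
rewrite add0r sum_vscale; apply/eqP => /(congr1 (dot f)).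
rewrite dotDr !dotZr (dotC f e) Hef; lra.
Qed.

(* After the free segments [w0] and [w1], the rest shrinks; the part of it
   beyond its first segment stays on the far side of the whole of [w0]. *)
Lemma uniq_spiral e f w0 w1 ws : orthobasis e f -> positive [:: w0, w1 & ws] ->
  0 < \sum_(c <- w1) c -> shrinking (sums ws) ->
  ((1 < size ws)%N -> \sum_(c <- w0) c + nth 0 (sums ws) 2 < nth 0 (sums ws) 0) ->
  uniq (pts 0 (wdirs e f [:: w0, w1 & ws])).
Proof.
move=> ef /and3P[Hw0 Hw1 Hp] y0 Hs Hx /=.
have fe := orthobasis_rot ef; have ee := orthobasis_rot fe.
have [He Hf Hef] := ef.
apply: uniq_pts_cat; first exact: uniq_segment.
  apply: uniq_pts_cat; first exact: uniq_segment.
    exact: uniq_shrinking.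
  move=> p q /(mem_pts_segment Hw1)[c _ ->] Hq.
  have [H _ _ _] := shrinking_box ee Hp Hs Hq.
  rewrite add0r sum_vscale; apply/eqP => /(congr1 (dot e)).
  by move: H; rewrite dotNl dotDr !dotZr Hef; lra.
move=> p q /(mem_pts_segment Hw0)[c /andP[c0 Hc] ->].
rewrite scanl_cat mem_cat add0r sum_vscale => Hq; apply/eqP => E.
have Ee := congr1 (dot e) E; have Ef := congr1 (dot f) E.
move: Ee Ef; rewrite !dotDr !dotZr (dotC f e) He Hef => Ee Ef.
case/orP: Hq => [/(mem_segment Hw1)[c' /andP[c'0 _] Eq]|].
  by move: Ef; rewrite Eq dotZr Hf; lra.
rewrite foldl_addE add0r sum_vscale scanl_shift => /mapP[r Hr Eq].
move: Ee Ef; rewrite Eq !dotDr !dotZr Hf Hef => Ee Ef.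
case: ws Hp Hs Hx Hr => [|w2 ws] //= /andP[Hw2 Hp] Hs Hx.
rewrite scanl_cat mem_cat => /orP[/(mem_segment Hw2)[c' /andP[c'0 _] Er]|].
  by move: Ef; rewrite Er dotZr dotC dotNl Hef; lra.
case: ws Hp Hs Hx => [|w3 ws] // Hp Hs /(_ isT) Hx.
rewrite foldl_addE add0r sum_vscale scanl_shift => /mapP[u Hu Er].
have Hp' : positive (w3 :: ws) by [].
have [_ _ H1 H2] := shrinking_box (orthobasis_rot ee) Hp' (shrinking_behead Hs) Hu.
(* Beyond [w2] the coordinate along [e] is at most the total of [w0], minus that of [w2], plus that
   of the segment two further in. This is negative by [Hx], but on [w0] the coordinate is
   nonnegative. *)
move: Ee H1 H2 Hx; rewrite Er dotDr dotZr !dotNl !opprK dotC dotNl He /=.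
lra.
Qed.
End WeightedSpiral.

(** * Paths as shapes, and what hangs below an edge *)

Section PathShapes.
Local Open Scope fset_scope.
Local Open Scope ring_scope.

(** [N] counts edges. Nodes are indexed by a function so that a node can be followed from its old
    index to its new one. *)
Definition pshape (N : nat) (q : nat -> pt) : Defs.shape :=
  Shape [fset q i | i in iota 0 N.+1] [fset edge (q i) (q i.+1) | i in iota 0 N].

Lemma pshape_VP N q x :
  reflect (exists2 i, (i <= N)%N & x = q i) (x \in sV (pshape N q)).
Proof.
apply: (iffP (imfsetP _ _ _ _)) => /= -[i Hi ->]; exists i => //.
  by move: Hi; rewrite -[0 :: _]/(iota 0 N.+1) mem_iota.
by rewrite -[0 :: _]/(iota 0 N.+1) mem_iota.
Qed.

Lemma pshape_EP N q x :
  reflect (exists2 i, (i < N)%N & x = edge (q i) (q i.+1)) (x \in sE (pshape N q)).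
Proof.
apply: (iffP (imfsetP _ _ _ _)) => /= -[i Hi ->]; exists i => //.
  by move: Hi; rewrite mem_iota.
by rewrite mem_iota.
Qed.

Lemma shape_eqP (S T : Defs.shape) : sV S =i sV T -> sE S =i sE T -> S = T.
Proof. by case: S T => [V E] [V' E'] /= /fsetP -> /fsetP ->. Qed.

Lemma edgeC x y : edge x y = edge y x.
Proof. exact: fsetUC. Qed.

Lemma edge_inj x y z w : edge x y = edge z w -> (x = z /\ y = w) \/ (x = w /\ y = z).
Proof.
move=> /fsetP H.
have Hx := H x; have Hy := H y; have Hz := H z; have Hw := H w.
move: Hx Hy Hz Hw; rewrite !in_fset2 !eqxx ?orbT ?orTb.
move=> /esym/orP[] /eqP-> /esym/orP[]/eqP->; rewrite ?orbb ?eqxx ?orbT ?orTb; auto.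
  by move=> _ /eqP ->; auto.
by move=> /eqP -> _; auto.
Qed.

Lemma eq_pshape N q q' : (forall i, (i <= N)%N -> q i = q' i) -> pshape N q = pshape N q'.
Proof.
move=> H; apply: shape_eqP => x.
  by apply/pshape_VP/pshape_VP => -[i Hi ->]; exists i; rewrite ?H.
by apply/pshape_EP/pshape_EP => -[i Hi ->]; exists i; rewrite ?H // ltnW.
Qed.

Lemma pshape_rev N q : pshape N q = pshape N (fun i => q (N - i)%N).
Proof.
apply: shape_eqP => x.
  apply/pshape_VP/pshape_VP => -[i Hi ->]; exists (N - i)%N; rewrite ?leq_subr //.
  by rewrite subKn.
apply/pshape_EP/pshape_EP => -[i Hi ->].
  exists (N - i.+1)%N; first by lia.
  by rewrite edgeC; congr (edge (q _) (q _)); lia.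
exists (N - i.+1)%N; first by lia.
by rewrite edgeC; congr (edge (q _) (q _)); lia.
Qed.

Lemma path_shapeE (s : seq pt) : s != [::] -> path_shape s = pshape (size s).-1 (nth pt0 s).
Proof.
case: s => // a s _; apply: shape_eqP => x.
  rewrite in_fset; apply/idP/pshape_VP => [/(nthP pt0)[i Hi <-]|[i Hi ->]].
    by exists i.
  exact: mem_nth.
apply/imfsetP/pshape_EP => /= -[].
  move=> [u v] /(nthP (pt0, pt0))[i]; rewrite size_zip /= => Hi.
  have Hi' : (i < size s)%N by move: Hi; rewrite leq_min => /andP[].
  rewrite nth_zip_cond size_zip Hi /= => -[<- <-] ->.
  by exists i.
move=> i /= Hi ->; exists (nth pt0 (a :: s) i, nth pt0 s i) => //.
have Hm : (i < minn (size s).+1 (size s))%N by rewrite leq_min Hi ltnW.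
apply/(nthP (pt0, pt0)); exists i; first by rewrite size_zip.
by rewrite nth_zip_cond size_zip /= Hm.
Qed.

Lemma paddE (p q : pt) : padd p q = p + q. Proof. by []. Qed.

Section PathTree.
Variables (N : nat) (q : nat -> pt).
Hypothesis q_inj : forall i j, (i <= N)%N -> (j <= N)%N -> q i = q j -> i = j.

Lemma edge_q_inj i j : (i < N)%N -> (j < N)%N ->
  edge (q i) (q i.+1) = edge (q j) (q j.+1) -> i = j.
Proof.
move=> Hi Hj /edge_inj[[H _]|[H1 H2]]; first by apply: q_inj => //; lia.
have := q_inj (ltnW Hi) Hj H1; have := q_inj Hi (ltnW Hj) H2; lia.
Qed.

(** Without edge [i], the indices up to [i] still lead back to the anchor one by one, and a walk
    starting beyond [i] can never bring its index down to [i]. *)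
Lemma hangsE i j : (i < N)%N -> (j <= N)%N ->
  hangs (sE (pshape N q)) (q 0%N) (edge (q i) (q i.+1)) (q j) = (i < j)%N.
Proof.
move=> Hi Hj; rewrite /hangs ltnNge; apply/asboolP/negP => [H Hji|Hji].
  apply: H; elim: j Hj Hji => [|j IH] Hj Hji; first exact: reach_refl.
  apply: (@reach_step _ _ (q j)); last by apply: IH; lia.
  rewrite in_fsetD1 edgeC; apply/andP; split; last by apply/pshape_EP; exists j.
  by apply/eqP => /(edge_q_inj Hj Hi); lia.
move=> H; apply: Hji; move: H; move Eqj: (q j) => x; move Ea: (q 0%N) => y H.
elim: H j Hj Eqj Ea => {x y}[x|x y z Hxy _ IH] j Hj Ej Ez.
  by have := q_inj Hj (leq0n N) (etrans Ej (esym Ez)); lia.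
move: Hxy; rewrite in_fsetD1 => /andP[/eqP Hne /pshape_EP[k Hk Ek]].
have Hki : k != i by apply/eqP => Hki; apply: Hne; rewrite Ek Hki.
case/edge_inj: (Ek) => -[Ex Ey].
  have Ejk : j = k by apply: q_inj; rewrite ?Ej //; lia.
  by have := IH k.+1 Hk (esym Ey) Ez; lia.
have Ejk : j = k.+1 by apply: q_inj; rewrite ?Ej //; lia.
by have := IH k (ltnW Hk) (esym Ey) Ez; lia.
Qed.

End PathTree.

Lemma cardinal_neqN d : d \in cardinal_dirs -> (- d == d) = false.
Proof. by rewrite !inE => /or4P[] /eqP->. Qed.

(** * One step splitting edges of a path *)

Section Split.
(** [Q] is the path after the step, [sg i] the new index of the old node [i], and [b i] tells
    whether the edge between nodes [i] and [i + 1] is split. *)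
Variables (N : nat) (q Q : nat -> pt) (sg : nat -> nat) (b : nat -> bool) (d : pt).
Hypothesis sg0 : sg 0%N = 0%N.
Hypothesis sgS : forall i, (i < N)%N -> sg i.+1 = (sg i + 1 + b i)%N.
Hypothesis Q0 : Q 0%N = q 0%N.
Hypothesis Q1 : forall i, (i < N)%N -> Q (sg i).+1 = Q (sg i) + (q i.+1 - q i).
Hypothesis Q2 : forall i, (i < N)%N -> b i ->
  Q (sg i).+2 = Q (sg i).+1 + (q i.+1 - q i).
Hypothesis d_card : d \in cardinal_dirs.
Hypothesis b_dir : forall i, (i < N)%N -> b i ->
  q i.+1 - q i = d \/ q i.+1 - q i = - d.
Hypothesis q_inj : forall i j, (i <= N)%N -> (j <= N)%N -> q i = q j -> i = j.
Hypothesis Q_inj : forall i j, (i <= sg N)%N -> (j <= sg N)%N -> Q i = Q j -> i = j.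

Let mix (t : rat) (x y : int) : rat := x%:~R + t * (y - x)%:~R.
Hypothesis no_collision : forall (t : rat) i j, 0 <= t <= 1 ->
  (i <= N)%N -> (j <= N)%N -> i != j ->
  (mix t (q i).1 (Q (sg i)).1, mix t (q i).2 (Q (sg i)).2) !=
  (mix t (q j).1 (Q (sg j)).1, mix t (q j).2 (Q (sg j)).2).

Let S := pshape N q.
Let a := q 0%N.
Let I := [fset i in iota 0 N | b i].
(** All operations must point toward [d], even on edges that the path traverses against [d]; hence
    the operation is put on the endpoint from which the other one is reached by [+ d]. *)
Let base i := if q i.+1 - q i == d then q i else q i.+1.
Let U := [fset base i | i in I].

Lemma sgE i : (i < N)%N -> Q (sg i.+1) = Q (sg i).+1 + (if b i then q i.+1 - q i else 0).
Proof.
move=> Hi; rewrite sgS //; case Hb: (b i); last by rewrite addn0 addn1 addr0.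
by rewrite -Q2 // !addn1.
Qed.

Lemma mem_I i : (i \in I) = (i < N)%N && b i.
Proof. by rewrite !inE /= mem_iota. Qed.

Lemma base_add i : i \in I ->
  (base i = q i /\ padd (base i) d = q i.+1 /\ q i.+1 - q i = d) \/
  (base i = q i.+1 /\ padd (base i) d = q i /\ q i.+1 - q i = - d).
Proof.
rewrite mem_I /base paddE => /andP[Hi Hb].
have D := subrK (q i) (q i.+1).
case: (b_dir Hi Hb) => E; rewrite E in D *.
  by left; rewrite eqxx -D addrC.
by right; rewrite cardinal_neqN // -D addrAC addNr add0r.
Qed.

Lemma edge_base i : i \in I -> edge (base i) (padd (base i) d) = edge (q i) (q i.+1).
Proof. by case/base_add => -[-> [-> _]] //; rewrite edgeC. Qed.

Lemma base_splits i : i \in I -> splits S d (base i).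
Proof.
move=> Hi; rewrite /splits edge_base //; apply/pshape_EP; exists i => //.
by move: Hi; rewrite mem_I => /andP[].
Qed.

Lemma base_inj : {in I &, injective base}.
Proof.
move=> i j Hi Hj E; have := edge_base Hi; rewrite E edge_base // => H.
by apply/esym/(edge_q_inj q_inj) => //; move: Hi Hj; rewrite !mem_I => /andP[? _] /andP[].
Qed.

(** The sign in [contrib] and the orientation of the edge relative to [d] cancel out: in both cases
    the nodes past the split edge are pushed by the edge vector. *)
Lemma contribE i j : i \in I -> (j <= N)%N ->
  pscale (contrib S a d (base i) (q j)) d = if (i < j)%N then q i.+1 - q i else 0.
Proof.
move=> Hi Hj; rewrite /contrib base_splits // edge_base //.
have /andP[HiN _] : (i < N)%N && b i by rewrite -mem_I.
rewrite (hangsE q_inj HiN Hj) /=; case: ltnP => Hij; last by rewrite /pscale !mul0r.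
case: (base_add Hi) => -[_ [-> ->]]; rewrite (hangsE q_inj) //; try lia.
  by rewrite ltnSn /pscale !mul1r; case: d.
by rewrite ltnn /pscale !mulN1r; case: d.
Qed.

(** The sum of the vectors of the split edges before [j] telescopes: each is what the new path gains
    over the old one at that edge. *)
Lemma dispE j : (j <= N)%N -> disp S a d U (q j) = Q (sg j) - q j.
Proof.
move=> Hj.
have -> : disp S a d U (q j) =
    \sum_(u <- U) pscale (contrib S a d u (q j)) d.
  rewrite /disp; elim: (enum_fset U) => [|u r IH]; rewrite ?big_nil ?big_cons.
    by rewrite /pscale !mul0r.
  by rewrite -IH /pscale !mulrDl.
rewrite big_imfset /=; last exact: base_inj.
rewrite (eq_big_seq (fun i => if (i < j)%N then q i.+1 - q i else 0)); last first.
  by move=> i Hi; rewrite contribE.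
have HI : perm_eq I [seq i <- iota 0 N | b i].
  apply: uniq_perm; first exact: fset_uniq.
    by rewrite filter_uniq ?iota_uniq.
  by move=> i; rewrite mem_I mem_filter mem_iota andbC.
rewrite (perm_big _ HI) big_filter -big_mkcondr /=.
transitivity (\sum_(0 <= i < j | b i) (q i.+1 - q i)).
  have -> : iota 0 N = index_iota 0 N by rewrite /index_iota subn0.
  rewrite [LHS]big_mkcond [RHS]big_mkcond /=.
  rewrite (@big_cat_nat _ _ _ j) //=.
  rewrite [X in _ + X]big_nat [X in _ + X]big1 ?addr0; last first.
    by move=> i /andP[Hi _]; rewrite ltnNge Hi andbF.
  by apply: eq_big_nat => i /andP[_ Hi]; rewrite Hi andbT.
elim: j Hj => [|j IH] Hj; first by rewrite big_geq // sg0 Q0 subrr.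
rewrite big_mkcond big_nat_recr // -big_mkcond /= IH 1?ltnW //.
rewrite sgE // Q1 //; case: (b j); case: (q j) (q j.+1) (Q (sg j)) => [? ?] [? ?] [? ?].
  by congr (_, _); rewrite /=; ring.
by congr (_, _); rewrite /=; ring.
Qed.

Lemma fposE j : (j <= N)%N -> fpos S a d U (q j) = Q (sg j).
Proof. by move=> Hj; rewrite /fpos dispE // paddE addrC subrK. Qed.

Lemma newposE i : i \in I -> newpos S a d U (base i) = Q (sg i).+1.
Proof.
move=> Hi; have /andP[HiN Hb] : (i < N)%N && b i by rewrite -mem_I.
rewrite /newpos paddE; case: (base_add Hi) => -[-> [_ E]].
  by rewrite fposE ?(ltnW HiN) // Q1 // E.
by rewrite fposE // sgE // Hb E subrK.
Qed.

Lemma leq_sg i j : (i <= j)%N -> (j <= N)%N -> (sg i <= sg j)%N.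
Proof.
move=> Hij; elim: j Hij => [|j IH] Hij Hj; first by have -> : i = 0%N by lia.
move: Hij; rewrite leq_eqVlt => /orP[/eqP->//|Hij].
have := IH Hij (ltnW Hj); have := sgS Hj; lia.
Qed.

Lemma ltn_sg i j : (i < j)%N -> (j <= N)%N -> (sg i + b i < sg j)%N.
Proof.
move=> Hij Hj; have := leq_sg Hij Hj; have := @sgS i; lia.
Qed.

Lemma sg_cases k : (k < sg N)%N ->
  exists2 i, (i < N)%N & k = sg i \/ (b i /\ k = (sg i).+1).
Proof.
elim: {-2}N (leqnn N) => [|n IH] Hn; first by rewrite sg0.
have [/(IH (ltnW Hn))[i Hi E] _|Hk] := ltnP k (sg n); first by exists i; rewrite // ltnW.
rewrite sgS // => Hk'; exists n => //.
have [->|Hkn] := eqVneq k (sg n); first by left.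
by right; case: (b n) Hk' => /= Hk'; split=> //; lia.
Qed.

Lemma mem_I_lt i : i \in I -> (i < N)%N /\ ((sg i).+1 < sg N)%N.
Proof.
rewrite mem_I => /andP[Hi Hb]; split=> //; have := ltn_sg Hi (leqnn N).
by rewrite Hb addn1.
Qed.

Lemma mem_U u : u \in U -> exists2 i, i \in I & u = base i.
Proof. by case/imfsetP => i /= Hi ->; exists i. Qed.

Lemma base_V i : i \in I -> exists2 j, (j <= N)%N & base i = q j.
Proof.
move=> Hi; have [HiN _] := mem_I_lt Hi.
by case: (base_add Hi) => -[-> _]; [exists i|exists i.+1] => //; lia.
Qed.

Lemma split_collision_free : collision_free S a d U.
Proof.
split; last split.
- move=> w1 w2 /pshape_VP[i Hi ->] /pshape_VP[j Hj ->] Hij t Ht.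
  rewrite /traj !dispE //; apply: no_collision => //.
  by apply: contra_neq Hij => ->.
- move=> u w /mem_U[i Hi ->] /pshape_VP[j Hj ->].
  have [HiN HiS] := mem_I_lt Hi; rewrite newposE // fposE //.
  apply/eqP => /Q_inj H; have {}H := H (ltnW HiS) (leq_sg Hj (leqnn N)).
  have [Hij|Hij] := leqP j i; first by have := leq_sg Hij (ltnW HiN); lia.
  by have := ltn_sg Hij Hj; move: Hi; rewrite mem_I => /andP[_ ->]; lia.
- move=> _ _ /mem_U[i Hi ->] /mem_U[j Hj ->] Hij; rewrite !newposE //.
  have [HiN HiS] := mem_I_lt Hi; have [HjN HjS] := mem_I_lt Hj.
  apply/eqP => /Q_inj H; have {}H := H (ltnW HiS) (ltnW HjS).
  case: (ltngtP i j) Hij => [Hij|Hij|->]; last by rewrite eqxx.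
    by have := ltn_sg Hij (ltnW HjN); lia.
  by have := ltn_sg Hij (ltnW HiN); lia.
Qed.

Lemma map_edgeE j : (j < N)%N ->
  map_edge S a d U (edge (q j) (q j.+1)) = edge (Q (sg j)) (Q (sg j.+1)).
Proof.
move=> Hj; apply/fsetP => x; rewrite in_fset2; apply/imfsetP/orP => /= [[y]|].
  by rewrite in_fset2 => /orP[] /eqP -> ->; rewrite fposE ?eqxx //; auto; exact: ltnW.
by case=> /eqP ->; [exists (q j)|exists (q j.+1)];
   rewrite ?in_fset2 ?eqxx ?orbT ?fposE //; exact: ltnW.
Qed.

(** The two halves are listed starting from the base, hence in path order or in reverse, according
    to the orientation of the edge. *)
Lemma base_edges i : i \in I ->
  let e1 := edge (fpos S a d U (base i)) (newpos S a d U (base i)) in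
  let e2 := edge (newpos S a d U (base i)) (fpos S a d U (padd (base i) d)) in
  let f1 := edge (Q (sg i)) (Q (sg i).+1) in
  let f2 := edge (Q (sg i).+1) (Q (sg i).+2) in
  (e1 = f1 /\ e2 = f2) \/ (e1 = f2 /\ e2 = f1).
Proof.
move=> Hi /=; have [HiN _] := mem_I_lt Hi; rewrite newposE //.
have E : sg i.+1 = (sg i).+2.
  by rewrite sgS //; move: Hi; rewrite mem_I => /andP[_ ->]; lia.
case: (base_add Hi) => -[-> [-> _]]; rewrite !fposE -?E //; try exact: ltnW.
  by left.
by right; split; rewrite edgeC.
Qed.

Lemma split_growth_step : growth_step a S (pshape (sg N) Q).
Proof.
exists d, U; split=> //.
- apply/fsubsetP => u /mem_U[i /base_V[j Hj ->] ->].
  by apply/pshape_VP; exists j.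
- exact: split_collision_free.
have mem_U' u : u \in U -> u \in [fset u in U | splits S d u].
  by move=> Hu; rewrite !inE /= Hu; have [i Hi ->] := mem_U Hu; rewrite base_splits.
apply: shape_eqP => x.
  rewrite in_fsetU; apply/pshape_VP/orP => [[k Hk ->]|].
    have [->|Hk'] := eqVneq k (sg N).
      by left; apply/imfsetP; exists (q N); rewrite ?fposE //=; apply/pshape_VP; exists N.
    have [|i Hi [->|[Hb ->]]] := @sg_cases k; first by lia.
      left; apply/imfsetP; exists (q i); last by rewrite fposE // (ltnW Hi).
      by apply/pshape_VP; exists i => //; apply: ltnW.
    have HiI : i \in I by rewrite mem_I Hi.
    right; apply/imfsetP; exists (base i); rewrite ?newposE //=.
    by apply: in_imfset.
  case=> /imfsetP[y /= Hy ->].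
    by have /pshape_VP[j Hj ->] := Hy; exists (sg j); rewrite ?leq_sg ?fposE.
  have [i Hi ->] := mem_U Hy; have [_ HiS] := mem_I_lt Hi.
  by exists (sg i).+1; rewrite ?newposE // ltnW.
rewrite !in_fsetU -orbA; apply/pshape_EP/or3P => [[k Hk ->]|].
  have [i Hi Hik] := sg_cases Hk.
  case Hb: (b i); last first.
    case: Hik => [Ek|[]]; last by rewrite Hb.
    apply: Or31; apply/imfsetP; exists (edge (q i) (q i.+1)) => /=; last first.
      by rewrite map_edgeE // sgS // Hb Ek addn0 addn1.
    rewrite in_fsetD; apply/andP; split; last by apply/pshape_EP; exists i.
    apply/imfsetP => -[u /= Hu E]; move: Hu; rewrite !inE /= => /andP[/mem_U[j Hj Eu] _].
    move: E; rewrite Eu edge_base // => /(edge_q_inj q_inj) E.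
    have [HjN _] := mem_I_lt Hj; move: Hj.
    by rewrite mem_I -(E Hi HjN) Hb andbF.
  have HiI : i \in I by rewrite mem_I Hi.
  have HU : base i \in U by apply: in_imfset.
  have HU' := mem_U' _ HU.
  have /= := base_edges HiI.
  case=> -[E1 E2]; case: Hik => [->|[_ ->]].
  + by apply: Or32; apply/imfsetP; exists (base i) => //; rewrite E1.
  + by apply: Or33; apply/imfsetP; exists (base i) => //; rewrite E2.
  + by apply: Or33; apply/imfsetP; exists (base i) => //; rewrite E2.
  + by apply: Or32; apply/imfsetP; exists (base i) => //; rewrite E1.
case=> /imfsetP[y /= Hy ->].
- move: Hy; rewrite in_fsetD => /andP[Hn /pshape_EP[j Hj Ey]].
  have Hb : b j = false.
    apply/negP => Hb; have Hj' : j \in I by rewrite mem_I Hj.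
    move/negP: Hn; apply; apply/imfsetP; exists (base j) => /=.
      by apply: mem_U'; apply: in_imfset.
    by rewrite Ey edge_base.
  exists (sg j); first by have := ltn_sg Hj (leqnn N); rewrite Hb addn0.
  by rewrite Ey map_edgeE // sgS // Hb addn0 addn1.
- have [i Hi ->] := mem_U Hy; have [_ HiS] := mem_I_lt Hi.
  by have /= [] := base_edges Hi => -[-> _]; [exists (sg i) => //; lia|exists (sg i).+1].
- have /mem_U[i Hi ->] : y \in U by move: Hy; rewrite !inE /= => /andP[].
  have [_ HiS] := mem_I_lt Hi.
  by have /= [] := base_edges Hi => -[_ ->]; [exists (sg i).+1|exists (sg i) => //; lia].
Qed.

End Split.

(** * One step adding a node at the end of a path *)

Section Append.
Variables (N : nat) (q : nat -> pt) (d a : pt).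
Hypothesis d_card : d \in cardinal_dirs.
Hypothesis q_inj : forall i j, (i <= N.+1)%N -> (j <= N.+1)%N -> q i = q j -> i = j.
Hypothesis q_last : q N.+1 = q N + d.

(** The last node has no edge toward [d], so the operation only creates a node and nothing moves. *)
Lemma append_growth_step : growth_step a (pshape N q) (pshape N.+1 q).
Proof.
set S := pshape N q; set U := [fset q N].
have nsplit : splits S d (q N) = false.
  apply/negP => /pshape_EP[i Hi]; rewrite paddE -q_last.
  by case/edge_inj => -[_ /q_inj E]; lia.
have disp0 w : disp S a d U w = 0.
  by rewrite /disp /U big_seq_fset1 /contrib nsplit /pscale !mul0r.
have fpos_id w : fpos S a d U w = w by rewrite /fpos disp0 paddE addr0.
have newposN : newpos S a d U (q N) = q N.+1 by rewrite /newpos fpos_id q_last.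
have noU : [fset u in U | splits S d u] = fset0.
  apply/fsetP => u; rewrite !inE /=; apply/negP => /andP[/eqP ->].
  by rewrite nsplit.
exists d, U; split=> //.
- by apply/fsubsetP => u; rewrite in_fset1 => /eqP->; apply/pshape_VP; exists N.
- split; last split.
  + move=> w1 w2 _ _ Hw t _; rewrite /traj !disp0 /= !mulr0 !addr0.
    apply: contra_neq Hw => -[/intr_inj + /intr_inj].
    by case: w1 w2 => [? ?] [? ?] /= -> ->.
  + move=> u w; rewrite in_fset1 => /eqP-> /pshape_VP[j Hj ->].
    by rewrite newposN fpos_id; apply/eqP => /q_inj; lia.
  + by move=> u1 u2; rewrite !in_fset1 => /eqP-> /eqP->; rewrite eqxx.
have map_id e : map_edge S a d U e = e.
  apply/fsetP => x; apply/imfsetP/idP => /= [[y Hy ->]|Hx]; first by rewrite fpos_id.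
  by exists x.
rewrite /step_result noU; apply: shape_eqP => x.
  rewrite in_fsetU; apply/pshape_VP/orP => [[k Hk ->]|].
    have [->|Hk'] := eqVneq k N.+1.
      by right; apply/imfsetP; exists (q N) => //=; rewrite in_fset1.
    by left; apply/imfsetP; exists (q k) => //; apply/pshape_VP; exists k => //; lia.
  case=> /imfsetP[y /= Hy ->].
    by rewrite fpos_id; have /pshape_VP[j Hj ->] := Hy; exists j => //; apply: ltnW.
  by move: Hy; rewrite in_fset1 => /eqP->; exists N.+1.
rewrite !in_fsetU; apply/pshape_EP/idP => [[k Hk ->]|].
  have [->|Hk'] := eqVneq k N.
    apply/orP; left; apply/orP; right; apply/imfsetP; exists (q N) => /=.
      by rewrite in_fset1.
    by rewrite fpos_id newposN.
  apply/orP; left; apply/orP; left; apply/imfsetP.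
  exists (edge (q k) (q k.+1)) => /=; last by rewrite map_id.
  rewrite in_fsetD; apply/andP; split; last by apply/pshape_EP; exists k => //; lia.
  by apply/imfsetP => -[u]; rewrite in_fset0.
case/orP => [/orP[]|] /imfsetP[y /= Hy ->]; last by rewrite in_fset0 in Hy.
  move: Hy; rewrite in_fsetD map_id => /andP[_ /pshape_EP[j Hj ->]].
  by exists j => //; lia.
by move: Hy; rewrite in_fset1 => /eqP->; exists N; rewrite ?fpos_id ?newposN.
Qed.
End Append.

End PathShapes.

(* Segment lengths listed from the anchor inwards. The first length may be
   [0], which covers the paths whose second segment already bounds the rest;
   [nth] returns [0] beyond the last segment. *)
Definition ok (l : seq nat) : Prop :=
  [/\ 1 < size l, 0 < nth 0 l 1,
      forall i, 1 < i < size l -> nth 0 l i.+2 < nth 0 l i &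
      3 < size l -> nth 0 l 0 + nth 0 l 4 < nth 0 l 2].

(** An edge is split at most once in a step, so a segment can at most double. *)
Definition between (l l' : seq nat) : Prop :=
  size l' = size l /\ forall i, nth 0 l i <= nth 0 l' i <= (nth 0 l i).*2.

Lemma between_refl l : between l l.
Proof. by split=> // i; lia. Qed.

Lemma between_ind (P : seq nat -> seq nat -> Prop) :
  P [::] [::] ->
  (forall x x' l l', x <= x' <= x.*2 -> between l l' -> P l l' -> P (x :: l) (x' :: l')) ->
  forall l l', between l l' -> P l l'.
Proof.
move=> P0 PS; elim=> [|x l IH] [|x' l'] [] //= [Hs] H.
have Hl : between l l' by split=> // i; exact: (H i.+1).
by apply: PS => //; [exact: (H 0)|exact: IH].
Qed.

(** * Stretching the segments of one axis *)

Section Stretch.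
Local Open Scope ring_scope.

(** Lengths of the old edges at time [t]: when a segment passes from length [x] to [x'], its
    [x' - x] split edges have length [1 + t] and the other [2 x - x'] keep length [1]. *)
Definition weights (R : realFieldType) (t : R) (l l' : seq nat) : seq (seq R) :=
  [seq nseq (p.2 - p.1)%N (1 + t) ++ nseq (p.1.*2 - p.2)%N 1 | p <- zip l l'].

Definition mask (l l' : seq nat) : seq bool :=
  flatten [seq nseq (p.2 - p.1)%N true ++ nseq (p.1.*2 - p.2)%N false | p <- zip l l'].

Lemma sum_nseq (V : zmodType) n (x : V) : \sum_(y <- nseq n x) y = x *+ n.
Proof. by rewrite big_nseq -Monoid.iteropE. Qed.

Section Uniq.
Variable R : realFieldType.
Implicit Types t : R.

Lemma nth_sums_weights t l l' i : between l l' ->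
  nth 0 (sums (weights t l l')) i = (1 - t) * (nth 0%N l i)%:R + t * (nth 0%N l' i)%:R.
Proof.
move=> H; elim/between_ind: H i => [|x x' {}l {}l' Hx _ IH] [|i];
  rewrite /= ?mulr0 ?addr0 //.
rewrite big_cat /= !sum_nseq.
have [n Hn ->] : exists2 n, (n <= x)%N & x' = (x + n)%N by exists (x' - x)%N; lia.
have -> : (x.*2 - (x + n) = x - n)%N by lia.
rewrite addKn natrD -[(1 + t) *+ n]mulr_natr natrB //.
ring.
Qed.

Lemma positive_weights t l l' : 0 <= t -> positive (weights t l l').
Proof.
move=> t0; rewrite /positive /weights all_map; apply/allP => -[x x'] _ /=.
by rewrite all_cat !all_nseq ltr01 (ltr_wpDr t0 ltr01) !orbT.
Qed.

Lemma ltr_mix t (x y x' y' : nat) : 0 <= t <= 1 -> (x < y)%N -> (x' < y')%N ->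
  (1 - t) * x%:R + t * x'%:R < (1 - t) * y%:R + t * y'%:R.
Proof.
rewrite -!(ltr_nat R) => /andP[t0 t1] Hx Hx'.
have [->|Ht] := eqVneq t 0; first by rewrite subr0 !mul0r !addr0 !mul1r.
rewrite ler_ltD //; first by rewrite ler_wpM2l ?subr_ge0 // ltW.
by rewrite ltr_pM2l // lt_def Ht.
Qed.

(** At time [t] the segment lengths are a convex combination of those of [l] and [l'], so they
    inherit the strict inequalities of [ok]. *)
Lemma uniq_weights t l l' e f : 0 <= t <= 1 -> orthobasis e f ->
  between l l' -> ok l -> ok l' -> uniq (pts 0 (wdirs e f (weights t l l'))).
Proof.
move=> Ht ef Hl [s1 y1 d1 x1] [s2 y2 d2 x2].
have Hn i := nth_sums_weights t i Hl; have [Hs _] := Hl.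
have Hsz : size (weights t l l') = size l by rewrite size_map size_zip Hs minnn.
have Hp : positive (weights t l l') by apply: positive_weights; case/andP: Ht.
case E: (weights t l l') Hn Hsz Hp => [|w0 [|w1 ws]] Hn Hsz Hp;
  [by rewrite -Hsz in s1 | by rewrite -Hsz in s1 |].
apply: uniq_spiral => //.
- have := Hn 1%N; rewrite /= => ->.
  by have := ltr_mix Ht y1 y2; rewrite !mulr0 addr0.
- move=> i; rewrite size_map => Hi.
  have := Hn i.+2; have := Hn i.+4; rewrite /= => -> ->.
  by apply: ltr_mix => //; [apply: d1|apply: d2]; rewrite ?Hs -Hsz.
- move=> H; have H3 : (3 < size l)%N by rewrite -Hsz.
  have := Hn 0%N; have := Hn 2%N; have := Hn 4%N; rewrite /= => -> -> ->.
  have := ltr_mix Ht (x1 H3) (x2 _); rewrite Hs => /(_ H3).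
  by rewrite !natrD; lra.
Qed.
End Uniq.

Definition emb (p : pt) : rat * rat := (p.1%:~R, p.2%:~R).

Lemma embD (p q : pt) : emb (p + q) = emb p + emb q.
Proof. by rewrite /emb /= !intrD. Qed.

Lemma embN (p : pt) : emb (- p) = - emb p.
Proof. by rewrite /emb /= !mulrNz. Qed.

Lemma emb_inj : injective emb.
Proof. by move=> [x y] [x' y'] [/intr_inj -> /intr_inj ->]. Qed.

Lemma map_emb_pts a v : map emb (pts a v) = pts (emb a) (map emb v).
Proof.
rewrite /pts /=; congr (_ :: _); elim: v a => //= x v IH a.
by rewrite IH embD.
Qed.

Definition dup (db : seq (pt * bool)) : seq pt :=
  flatten [seq nseq (nat_of_bool p.2).+1 p.1 | p <- db].

Definition stretched (t : rat) (db : seq (pt * bool)) : seq (rat * rat) :=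
  [seq vscale (1 + t * (nat_of_bool p.2)%:R) (emb p.1) | p <- db].

Lemma size_mask l l' : between l l' -> size (mask l l') = sumn l.
Proof.
move=> H; elim/between_ind: H => //= x x' {}l {}l' Hx _ IH.
by rewrite /mask /= !size_cat !size_nseq -/(mask l l') IH; lia.
Qed.

Lemma size_dirs (V : zmodType) (e f : V) l : size (dirs e f l) = sumn l.
Proof. by elim: l e f => //= x l IH e f; rewrite size_cat size_nseq IH. Qed.

Lemma zip_nseq (S T : Type) n (x : S) (y : T) : zip (nseq n x) (nseq n y) = nseq n (x, y).
Proof. by elim: n => //= n ->. Qed.

Lemma dirs_mask e f x x' l l' : (x <= x' <= x.*2)%N ->
  zip (dirs e f (x :: l)) (mask (x :: l) (x' :: l')) =
  nseq (x' - x)%N (e, true) ++ nseq (x.*2 - x')%N (e, false) ++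
  zip (dirs f (- e : pt) l) (mask l l').
Proof.
move=> Hx; rewrite /mask /= -/(mask l l') -catA.
have {1}-> : x = ((x' - x) + (x.*2 - x'))%N by lia.
by rewrite nseqD -catA !zip_cat ?size_nseq ?zip_nseq.
Qed.

Lemma dup_cat d1 d2 : dup (d1 ++ d2) = dup d1 ++ dup d2.
Proof. by rewrite /dup map_cat flatten_cat. Qed.

Lemma dup_nseq n (e : pt) b : dup (nseq n (e, b)) = nseq (n * b.+1)%N e.
Proof.
elim: n => // n IH; rewrite -[nseq n.+1 _]/(nseq 1 (e, b) ++ nseq n (e, b)).
by rewrite dup_cat IH mulSn nseqD /dup /= cats0.
Qed.

Lemma dup_dirs e f l l' : between l l' ->
  dup (zip (dirs e f l) (mask l l')) = dirs e f l'.
Proof.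
move=> H; elim/between_ind: H e f => //= x x' {}l {}l' Hx _ IH e f.
rewrite -/(dirs e f (x :: l)) dirs_mask // !dup_cat IH !dup_nseq catA -nseqD.
by congr (nseq _ _ ++ _); lia.
Qed.

Lemma stretched_dirs t e f l l' : between l l' ->
  stretched t (zip (dirs e f l) (mask l l')) = wdirs (emb e) (emb f) (weights t l l').
Proof.
move=> H; elim/between_ind: H e f => //= x x' {}l {}l' Hx _ IH e f.
rewrite -/(dirs e f (x :: l)) dirs_mask // /stretched !map_cat !map_nseq /=.
by rewrite -/(stretched _ _) IH embN mulr1 mulr0 addr0 !catA.
Qed.

(** Segments alternate between two axes. If only one parity changes, all split edges are parallel
    and a single cardinal direction serves all operations. *)
Lemma mask_dir (par : bool) e f l l' : between l l' ->
  (forall i, nth 0%N l i != nth 0%N l' i -> odd i = par) ->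
  forall p, p \in zip (dirs e f l) (mask l l') -> p.2 ->
  p.1 = (if par then f else e : pt) \/ p.1 = - (if par then f else e : pt).
Proof.
move=> H; elim/between_ind: H par e f => //= x x' {}l {}l' Hx _ IH par e f Hpar p.
rewrite -/(dirs e f (x :: l)) dirs_mask // !mem_cat => /or3P[||Hp Hp2].
- rewrite mem_nseq => /andP[Hxx' /eqP -> _] /=; left.
  by have <- : odd 0 = par by apply: Hpar => /=; lia.
- by rewrite mem_nseq => /andP[_ /eqP ->].
have Hpar' i : nth 0%N l i != nth 0%N l' i -> odd i = ~~ par.
  by move=> Hi; rewrite -(Hpar i.+1 Hi) /= negbK.
have := IH _ f (- e) Hpar' p Hp Hp2.
by case: (par) => /= -[] ->; rewrite ?opprK; auto.
Qed.

Lemma orthobasis_emb (e f : pt) : e \in cardinal_dirs ->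
  f = rot_ccw e \/ f = rot_cw e -> orthobasis (emb e) (emb f).
Proof. by rewrite !inE => /or4P[] /eqP-> [] ->; split. Qed.

Lemma uniq_ok a e f l : e \in cardinal_dirs -> f = rot_ccw e \/ f = rot_cw e ->
  ok l -> uniq (pts a (dirs e f l)).
Proof.
move=> He Hf Hl; rewrite uniq_pts_shift -(map_inj_uniq emb_inj) map_emb_pts.
have -> : map emb (dirs e f l) = wdirs (emb e) (emb f) (weights 0 l l).
  rewrite -stretched_dirs; last exact: between_refl.
  rewrite /stretched -[in LHS](@unzip1_zip _ _ (dirs e f l) (mask l l)); last first.
    by rewrite size_dirs size_mask //; exact: between_refl.
  rewrite -map_comp; apply: eq_map => p /=.
  by rewrite mul0r addr0 /vscale !mul1r; case: (emb _).
apply: uniq_weights => //; first exact: orthobasis_emb.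
exact: between_refl.
Qed.

(** Ties the weighted walk to the motion: its points at time [t] are those of [traj], a fraction [t]
    of the way from old to new position. *)
Lemma sum_stretched t (a : pt) db :
  emb a + \sum_(x <- stretched t db) x =
  (let x := a + \sum_(x <- unzip1 db) x in let y := a + \sum_(x <- dup db) x in
   (x.1%:~R + t * (y.1 - x.1)%:~R, x.2%:~R + t * (y.2 - x.2)%:~R)).
Proof.
elim/last_ind: db => [|db [v b] IH] /=.
  by rewrite !big_nil !addr0 !subrr !mulr0 !addr0.
rewrite /stretched /dup /unzip1 !map_rcons flatten_rcons -!cats1 !big_cat /=.
rewrite !big_seq1 -/(stretched t db) -/(dup db) -/(unzip1 db) !addrA IH /=.
rewrite big_cons; case: b; rewrite /= ?big_seq1 ?big_nil /vscale; congr (_, _) => /=; ring.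
Qed.

Lemma nth_pts_cat x0 (a : pt) v w k :
  nth x0 (pts a (v ++ w)) (size v + k) = nth x0 (pts (a + \sum_(x <- v) x) w) k.
Proof.
elim: v a => [|x v IH] a; first by rewrite big_nil addr0.
by rewrite big_cons addrA -IH.
Qed.

Lemma add_add_sub (V : zmodType) (a x v : V) : a + (x + v) - (a + x) = v.
Proof. by rewrite (addrA a) [a + x + v]addrC addrK. Qed.

Lemma stretch_step a e f par l l' : e \in cardinal_dirs ->
  f = rot_ccw e \/ f = rot_cw e -> between l l' -> ok l -> ok l' ->
  (forall i, nth 0%N l i != nth 0%N l' i -> odd i = par) ->
  growth_step a (path_shape (pts a (dirs e f l))) (path_shape (pts a (dirs e f l'))).
Proof.
move=> He Hf Hl okl okl' Hpar.
have U := uniq_ok a He Hf okl; have U' := uniq_ok a He Hf okl'.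
have Hdir := mask_dir (e := e) (f := f) Hl Hpar.
have Hdup := dup_dirs e f Hl.
have Hunz : unzip1 (zip (dirs e f l) (mask l l')) = dirs e f l.
  by rewrite unzip1_zip // size_dirs size_mask.
(* Simplicity of the weighted walk at each time [t] is what excludes collisions. *)
have Hcol t : 0 <= t <= 1 -> uniq (pts (emb a) (stretched t (zip (dirs e f l) (mask l l')))).
  move=> Ht; rewrite uniq_pts_shift stretched_dirs // uniq_weights //.
  exact: orthobasis_emb.
move: (zip _ _) Hdir Hdup Hunz Hcol => db Hdir Hdup Hunz Hcol.
rewrite -Hunz -Hdup in U U' *.
rewrite !path_shapeE // !size_pts !succnK.
set d := if par then f else e in Hdir.
have dc : d \in cardinal_dirs.
  rewrite /d; case: (par) => //; case: Hf => ->; move: He; rewrite !inE;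
  by move=> /or4P[] /eqP->.
(* The new index of a node counts the unit edges replacing the first [i] edges. *)
pose sg i := size (dup (take i db)).
pose b i := (nth (pt0, false) db i).2.
have dbE i : (i < size db)%N -> dup db =
    dup (take i db) ++ nseq (b i).+1 (nth (pt0, false) db i).1 ++ dup (drop i.+1 db).
  move=> Hi; rewrite -{1}(cat_take_drop i db) (drop_nth (pt0, false)) //.
  by rewrite dup_cat.
have szU : size (unzip1 db) = size db by rewrite size_map.
have qS i : (i < size db)%N -> nth pt0 (pts a (unzip1 db)) i.+1 -
    nth pt0 (pts a (unzip1 db)) i = (nth (pt0, false) db i).1.
  move=> Hi; rewrite !nth_pts ?szU // 1?ltnW //.
  rewrite (take_nth pt0) ?szU // -cats1 big_cat big_seq1 /=.
  by rewrite (nth_map (pt0, false)) //; exact: add_add_sub.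
have QE i k : (i < size db)%N -> nth pt0 (pts a (dup db)) (sg i + k) =
    nth pt0 (pts (a + \sum_(x <- dup (take i db)) x)
     (nseq (b i).+1 (nth (pt0, false) db i).1 ++ dup (drop i.+1 db))) k.
  by move=> Hi; rewrite (dbE i Hi) nth_pts_cat.
have sgN : sg (size db) = size (dup db) by rewrite /sg take_size.
have QsgE i : (i <= size db)%N ->
    nth pt0 (pts a (dup db)) (sg i) = a + \sum_(x <- dup (take i db)) x.
  rewrite leq_eqVlt => /orP[/eqP->|Hi]; last by rewrite -[sg i]addn0 QE.
  by rewrite nth_pts sgN // take_size take_oversize.
rewrite szU -sgN.
apply: (@split_growth_step (size db) _ _ sg b d) => //.
- by rewrite /sg take0.
- move=> i Hi; rewrite /sg (take_nth (pt0, false)) // -cats1 dup_cat size_cat.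
  by rewrite /dup /= cats0 size_nseq -addnA add1n.
- by move=> i Hi; rewrite qS // QsgE ?(ltnW Hi) // -[(sg i).+1]addn1 QE.
- by move=> i Hi Hb; rewrite qS // -[(sg i).+2]addn2 -[(sg i).+1]addn1 !QE // Hb.
- move=> i Hi Hb; rewrite qS //; apply: Hdir => //; exact: mem_nth.
- move=> i j Hi Hj /eqP; rewrite nth_uniq ?size_pts ?szU ?ltnS //; exact: eqP.
- move=> i j; rewrite sgN => Hi Hj /eqP; rewrite nth_uniq ?size_pts ?ltnS //; exact: eqP.
move=> t i j Ht Hi Hj Hij.
have HE k : (k <= size db)%N -> nth 0 (pts (emb a) (stretched t db)) k =
   (let x := nth pt0 (pts a (unzip1 db)) k in let y := nth pt0 (pts a (dup db)) (sg k) in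
   (x.1%:~R + t * (y.1 - x.1)%:~R, x.2%:~R + t * (y.2 - x.2)%:~R)).
  move=> Hk; rewrite nth_pts ?size_map // -map_take -/(stretched t _) sum_stretched.
  by rewrite QsgE // nth_pts ?szU // /unzip1 map_take.
have := HE i Hi; have := HE j Hj => /= <- <-.
by rewrite nth_uniq ?Hcol // size_pts size_map ltnS.
Qed.
End Stretch.

(** * Growing the smallest spiral, then enlarging it *)

Definition grown (a : pt) (t : nat) (v : seq pt) : Prop :=
  exists2 t', t' <= t & grows a t' (Shape [fset a]%fset fset0) (path_shape (pts a v)).

Lemma grown_nil a : grown a 0 [::].
Proof.
exists 0 => //; suff -> : path_shape (pts a [::]) = Shape [fset a]%fset fset0 by exact: grows0.
rewrite path_shapeE //; apply: shape_eqP => x /=.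
  by apply/imfsetP/fset1P => /= [[i]|->]; [rewrite inE => /eqP-> ->|exists 0].
by rewrite in_fset0; apply/imfsetP => -[i].
Qed.

Lemma grown_append a t v d : d \in cardinal_dirs -> uniq (pts a (rcons v d)) ->
  grown a t v -> grown a t.+1 (rcons v d).
Proof.
move=> Hd U [t' Ht' G]; exists t'.+1 => //; apply: growsS G _.
have E i : i <= size v -> nth pt0 (pts a v) i = nth pt0 (pts a (rcons v d)) i.
  by move=> Hi; rewrite -cats1 pts_cat nth_cat size_pts ltnS Hi.
rewrite !path_shapeE // !size_pts size_rcons !succnK (eq_pshape E).
apply: (append_growth_step a Hd).
  move=> i j Hi Hj /eqP; rewrite nth_uniq ?size_pts ?size_rcons ?ltnS //; exact: eqP.
rewrite !nth_pts ?size_rcons // take_oversize ?size_rcons //.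
by rewrite -cats1 take_size_cat // big_cat big_seq1 /= addrA.
Qed.

Lemma cardinal_rot (e f : pt) : e \in cardinal_dirs -> f = rot_ccw e \/ f = rot_cw e ->
  f \in cardinal_dirs /\ (- e)%R \in cardinal_dirs.
Proof. by rewrite !inE => /or4P[] /eqP -> [] ->. Qed.

Lemma dirs_rcons1 (e f : pt) l : e \in cardinal_dirs -> f \in cardinal_dirs ->
  exists2 d, d \in cardinal_dirs & dirs e f (rcons l 1) = rcons (dirs e f l) d.
Proof.
elim: l e f => [|n l IH] e f He Hf /=; first by exists e.
have He' : (- e)%R \in cardinal_dirs by move: He; rewrite !inE => /or4P[]/eqP->.
by have [d Hd ->] := IH f (- e)%R Hf He'; exists d => //; rewrite rcons_cat.
Qed.

Section Growth.
Variables (a e f : pt).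
Hypothesis e_card : e \in cardinal_dirs.
Hypothesis f_rot : f = rot_ccw e \/ f = rot_cw e.

(* Every constraint of [ok] relates segments of the same parity, so the two
   axes can be stretched one after the other. *)
Lemma grown_stretch l l' t : between l l' -> ok l -> ok l' ->
  grown a t (dirs e f l) -> grown a t.+2 (dirs e f l').
Proof.
move=> [Hs Hb] okl okl' [t' Ht' G].
pose m := mkseq (fun i => if odd i then nth 0 l i else nth 0 l' i) (size l).
have nm i : nth 0 m i = if odd i then nth 0 l i else nth 0 l' i.
  have [Hi|Hi] := ltnP i (size l); first by rewrite nth_mkseq.
  by rewrite !nth_default ?size_mkseq ?Hs ?if_same.
have okm : ok m.
  case: okl okl' => [s1 y1 d1 x1] [s2 y2 d2 x2]; split; rewrite ?size_mkseq //.
  - by rewrite nm.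
  - by move=> i Hi; rewrite !nm /= negbK; case: odd; [exact: d1|apply: d2; rewrite Hs].
  - by move=> H; rewrite !nm; apply: x2; rewrite Hs.
have b1 : between l m.
  by split; rewrite ?size_mkseq // => i; rewrite nm; case: odd => //; lia.
have b2 : between m l'.
  split; rewrite ?size_mkseq // => i; rewrite nm.
  by case: odd => //; have := Hb i; lia.
exists t'.+2 => //; apply: growsS; first apply: growsS G _.
  apply: (stretch_step a (par := false) e_card f_rot b1 okl okm) => i.
  by rewrite nm; case: odd; rewrite ?eqxx.
apply: (stretch_step a (par := true) e_card f_rot b2 okm okl') => i.
by rewrite nm; case: odd; rewrite ?eqxx.
Qed.

(* The smallest admissible lengths of a spiral with [j + 2] segments whose
   first segment is nonempty iff [x]. *)
Definition base (x : bool) (j i : nat) : nat :=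
  if i is i'.+1 then
    if i' is i''.+1 then uphalf (j - i'') + [&& x, i'' == 0 & 1 < j] else 1
  else x.


Lemma nth0_mkseq (F : nat -> nat) n i : nth 0 (mkseq F n) i = if i < n then F i else 0.
Proof.
by case: ltnP => Hi; [rewrite nth_mkseq|rewrite nth_default ?size_mkseq].
Qed.

(** The case [j' = j + 1] is the intermediate spiral, already lengthened but still lacking its last
    segment. *)
Lemma ok_base x j j' : j <= j' <= j.+1 -> ok (mkseq (base x j') j.+2).
Proof.
move=> Hj; split; rewrite ?size_mkseq ?nth0_mkseq //.
  move=> [|[|i]] // Hi; rewrite !nth0_mkseq /=.
  by have -> : i.+2 < j.+2 by []; case: ifP => _; lia.
move=> H; have -> : 2 < j.+2 by lia.
have Hj' : 1 < j' by lia.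
by rewrite /= Hj' andbF andbT; case: x; case: ifP => _; lia.
Qed.

(** Each length grows by at most one, and those that change are already positive. *)
Lemma between_base x j :
  between (mkseq (base x j) j.+2) (mkseq (base x j.+1) j.+2).
Proof.
split; rewrite ?size_mkseq // => i; rewrite !nth0_mkseq.
by case: ifP => // Hi; case: i Hi => [|[|i]] /= Hi; lia.
Qed.

Lemma base_rcons x j : mkseq (base x j.+1) j.+3 = rcons (mkseq (base x j.+1) j.+2) 1.
Proof. by rewrite mkseqS /= subSnn; case: j => [|j] /=; rewrite ?ltnn ?andbF. Qed.

Lemma grown_base x j : grown a (2 + 3 * j) (dirs e f (mkseq (base x j) j.+2)).
Proof.
have [f_card _] := cardinal_rot e_card f_rot.
elim: j => [|j IH]; last first.
  have ok1 : ok (mkseq (base x j) j.+2) by apply: ok_base; lia.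
  have ok2 : ok (mkseq (base x j.+1) j.+2) by apply: ok_base; lia.
  have ok3 : ok (mkseq (base x j.+1) j.+3) by apply: ok_base; lia.
  (* Each new segment costs two stretching steps and one appended node. *)
  have -> : 2 + 3 * j.+1 = (2 + 3 * j).+3 by lia.
  have U := uniq_ok a e_card f_rot ok3; move: U; rewrite base_rcons.
  have [d Hd ->] := dirs_rcons1 (mkseq (base x j.+1) j.+2) e_card f_card.
  move=> U; apply: grown_append => //.
  exact: grown_stretch (between_base x j) ok1 ok2 IH.
have ok0 : ok (mkseq (base x 0) 2) by apply: ok_base.
have U := uniq_ok a e_card f_rot ok0.
have G1 : grown a 1 (dirs e f [:: nat_of_bool x]).
  (* If [x] is false the first segment is empty and takes no step; [grown] only bounds the number of
     steps. *)
  case: x U {ok0} => U; last by have [t Ht G] := grown_nil a; exists t; rewrite // ltnW.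
  apply: (@grown_append a 0 [::] e) => //; last exact: grown_nil.
  by move: U; rewrite /= !inE negb_or => /andP[/andP[-> _] _].
have E : dirs e f (mkseq (base x 0) 2) = rcons (dirs e f [:: nat_of_bool x]) f.
  by case: x {U ok0 G1}.
by rewrite E in U *; apply: grown_append.
Qed.

(** Each length from the third on exceeds the one two further in, which forces at least half the
    number of segments from there to the inner end, rounded up. *)
Lemma base_leq L i : ok L -> i < size L -> base (0 < nth 0 L 0) (size L).-2 i <= nth 0 L i.
Proof.
case=> s1 y1 d1 x1.
have H k n : k = (size L).-2 - n -> n < (size L).-2 -> uphalf k <= nth 0 L n.+2.
  elim/ltn_ind: k n => k IH n Ek Hn.
  have Hd := d1 n.+2; have Hl : nth 0 L n.+4 < nth 0 L n.+2 by apply: Hd; lia.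
  case: k IH Ek => [|[|k]] IH Ek //=; first by lia.
  by have := IH k _ n.+2; lia.
case: i => [|[|i]] Hi //=; first by lia.
have := H _ i erefl; case: i Hi => [|i] Hi /=; last by rewrite andbF addn0; apply; lia.
(* The extra unit of the third segment: it must exceed the first and the fifth together. *)
case: (ltnP 1 (size L).-2) => Hj; last by rewrite andbF addn0; apply; lia.
move=> _; rewrite andbT; have := x1; have := H _ 2 erefl.
by move: (nth 0 L 0) (nth 0 L 4) (nth 0 L 2) (size L) Hj => p q r n; lia.
Qed.

Definition interp (L : seq nat) (k : nat) : seq nat :=
  let c i := base (0 < nth 0 L 0) (size L).-2 i in
  mkseq (fun i => c i + (nth 0 L i - c i) %/ 2 ^ k) (size L).

(** Rounding down is superadditive; this serves the one inequality of [ok] with a sum on its smaller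
    side. *)
Lemma leq_divD2 m n p d : 0 < d -> m + n <= p -> m %/ d + n %/ d <= p %/ d.
Proof.
move=> d0 H; rewrite leq_divRL // mulnDl; apply: leq_trans H.
by rewrite leq_add // leq_trunc_div.
Qed.

(** The base lengths supply strictness, so it suffices that the excesses of [L] over them satisfy
    the weak inequalities, which survive division. They do, because the margins between base lengths
    are as small as the constraints allow. *)
Lemma ok_interp L k : ok L -> ok (interp L k).
Proof.
move=> okL; have k0 : 0 < 2 ^ k by rewrite expn_gt0.
have [s1 y1 d1 x1] := okL.
have Hsz : (size L).-2.+2 = size L by lia.
have [_ _ dc xc] := @ok_base (0 < nth 0 L 0) (size L).-2 (size L).-2 ltac:(lia).
rewrite Hsz in dc xc; rewrite size_mkseq in dc xc.
split; rewrite ?size_mkseq //.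
- by rewrite nth0_mkseq s1.
- move=> i Hi; have /andP[_ Hi2] := Hi.
  have Hc := dc i Hi; have HL := d1 i Hi.
  rewrite /interp !nth0_mkseq Hi2 in Hc *; case: ifP => Hi4; last first.
    by rewrite Hi4 in Hc; apply: leq_trans Hc _; rewrite leq_addr.
  rewrite Hi4 in Hc; rewrite -addSn leq_add // leq_div2r //.
  have B := base_leq okL Hi4; have B' := base_leq okL Hi2.
  (* Between the third and fifth base lengths the margin may be two; then the nonempty first segment
     makes the margin in [L] at least two as well. *)
  case: i Hi Hi2 Hc HL Hi4 B B' => [|[|i]] // Hi Hi2 Hc HL Hi4 B B'.
  move: B B'; rewrite /= andbF addn0; case: i Hi Hi2 Hc HL Hi4 => [|i] Hi Hi2 Hc HL Hi4 /=;
    last by rewrite andbF addn0; lia.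
  have H3 : 3 < size L by lia.
  have := x1 H3; move: HL; move: (nth 0 L 0) (nth 0 L 2) (nth 0 L 4) => p q r.
  by case: (ltnP 0 p) => Hp /=; lia.
move=> H3; have Hc := xc H3; have HL := x1 H3.
have B0 := base_leq okL (ltnW s1); have H2 : 2 < size L by lia.
have B2 := base_leq okL H2.
rewrite !nth0_mkseq H2 (ltnW s1) in Hc; rewrite /interp !nth0_mkseq H2 (ltnW s1).
case: ifP => H4; rewrite H4 in Hc.
  have B4 := base_leq okL H4.
  set c0 := base _ _ 0 in Hc B0 *; set c2 := base _ _ 2 in Hc B2 *.
  set c4 := base _ _ 4 in Hc B4 *.
  rewrite addnACA -addSn leq_add // leq_divD2 //.
  have E : c2 = c0 + c4 + 1.
    rewrite /c0 /c2 /c4 /= andbF addn0 ?eqxx; have -> : 1 < (size L).-2 by lia.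
    by rewrite !andbT; lia.
  by lia.
rewrite addn0 in Hc; rewrite addn0.
set c0 := base _ _ 0 in Hc B0 *; set c2 := base _ _ 2 in Hc B2 *.
rewrite -addSn leq_add // leq_div2r //.
have E : c2 = c0 + 1.
  rewrite /c0 /c2 /= ?eqxx; have -> : (size L).-2 = 2 by lia.
  by rewrite !andbT; lia.
by lia.
Qed.

(** A quotient [m] becomes at most [2 m + 1], and a positive base length absorbs the odd unit. *)
Lemma between_interp L k : ok L -> between (interp L k.+1) (interp L k).
Proof.
move=> okL; have [s1 _ _ _] := okL.
split; rewrite ?size_mkseq // => i; rewrite !nth0_mkseq.
case: ifP => // Hi; rewrite expnS mulnC divnMA.
(* A base length [0] occurs only for an empty first segment, which stays empty. *)
have [Hx|Hx] := posnP (base (0 < nth 0 L 0) (size L).-2 i); last by move: (_ %/ 2 ^ k) => n; lia.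
case: i Hi Hx => [|[|i]] Hi Hx //; last by move: Hx => /=; lia.
move: Hx => /=; case: (nth 0 L 0) => //= _; rewrite !div0n; lia.
Qed.

(** After the smallest spiral is built, each of the [R] stages costs two steps, one per axis. *)
Lemma grown_ok L R : ok L -> (forall i, nth 0 L i < 2 ^ R) ->
  grown a (2 + 3 * size L + 2 * R) (dirs e f L).
Proof.
move=> okL HR; have [s1 _ _ _] := okL.
have H k : k <= R -> grown a (2 + 3 * size L + 2 * k) (dirs e f (interp L (R - k))).
  elim: k => [|k IH] Hk.
    (* Division by [2 ^ R] leaves no excess, so the first stage is the smallest spiral. *)
    have -> : interp L (R - 0) = mkseq (base (0 < nth 0 L 0) (size L).-2) (size L).-2.+2.
      have -> : (size L).-2.+2 = size L by lia.
      apply: eq_mkseq => i; rewrite subn0 divn_small ?addn0 //.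
      by apply: leq_ltn_trans (HR i); rewrite leq_subr.
    have [t Ht G] := grown_base (0 < nth 0 L 0) (size L).-2.
    by exists t => //; lia.
  have -> : 2 + 3 * size L + 2 * k.+1 = (2 + 3 * size L + 2 * k).+2 by lia.
  apply: grown_stretch (IH (ltnW Hk)); try exact: ok_interp.
  have -> : R - k = (R - k.+1).+1 by lia.
  exact: between_interp.
have := H R (leqnn R); rewrite subnn.
suff -> : interp L 0 = L by [].
apply: (@eq_from_nth _ 0); rewrite size_mkseq // => i Hi.
by rewrite nth0_mkseq Hi expn0 divn1 subnKC // base_leq.
Qed.
End Growth.

(** * Inequalities forced by the absence of closed subwalks *)

Section ClosedWalks.
Variable V : zmodType.
Local Open Scope ring_scope.
Implicit Types (a e f : V) (u v w : seq V) (l : seq nat).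

Lemma mem_pts_prefix a u w : a + \sum_(x <- u) x \in pts a (u ++ w).
Proof.
by rewrite pts_cat mem_cat -(last_pts 0 a u) -[last 0 _]/(last a _) mem_last.
Qed.

Lemma uniq_no_closed_subwalk a u v w : uniq (pts a (u ++ v ++ w)) ->
  \sum_(x <- v) x = 0 -> v = [::].
Proof.
move=> U H; apply/nilP/eqP.
have E : nth 0 (pts a (u ++ v ++ w)) (size u + size v) = nth 0 (pts a (u ++ v ++ w)) (size u).
  rewrite !nth_pts ?size_cat ?leq_addr //; last by rewrite addnA leq_addr.
  rewrite [take (size u) _]take_size_cat // catA take_size_cat ?size_cat //.
  by rewrite big_cat /= H addr0.
move/eqP: E; rewrite nth_uniq // ?size_pts ?size_cat ?ltnS ?leq_addr //;
  last by rewrite addnA leq_addr.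
lia.
Qed.

Lemma uniq_pts_drop a v w : uniq (pts a (v ++ w)) -> uniq (pts (a + \sum_(x <- v) x) w).
Proof.
elim: v a => [|x v IH] a; first by rewrite big_nil addr0.
by rewrite big_cons addrA => /andP[_]; exact: IH.
Qed.

(** If both failed, with lengths [D], [C], [B], [A] in order, the last [B] steps of the first
    segment, the second, the third, and the first [C] steps of the fourth would close up to a
    rectangle. *)
Lemma four_segments a e f l i : all (leq 1) l -> uniq (pts a (dirs e f l)) ->
  (i.+3 < size l)%N ->
  (nth 0 l i < nth 0 l i.+2)%N \/ (nth 0 l i.+3 < nth 0 l i.+1)%N.
Proof.
move=> Hl U Hi.
have Hpos k : (k < size l)%N -> (0 < nth 0%N l k)%N by move=> Hk; apply: (all_nthP 0%N Hl).
have [//|HB] := ltnP (nth 0%N l i) (nth 0%N l i.+2); first by left.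
have [//|HC] := ltnP (nth 0%N l i.+3) (nth 0%N l i.+1); first by right.
exfalso; have := Hpos i.+1; move: U HB HC.
have [e' [f' ->]] : exists e' f', dirs e f l = dirs e f (take i l) ++ dirs e' f' (drop i l).
  by rewrite -{1}(cat_take_drop i l); exact: dirs_cat.
do 4!rewrite (drop_nth 0%N) ?(ltnW (ltnW (ltnW Hi))) ?(ltnW (ltnW Hi)) ?(ltnW Hi) //.
move: (nth _ _ i) (nth _ _ i.+1) (nth _ _ i.+2) (nth _ _ i.+3) => D C B A.
move=> /uniq_pts_drop U HB HC /(_ isT) C0.
have E : dirs e' f' [:: D, C, B, A & drop i.+4 l] = nseq (D - B)%N e' ++
    (nseq B e' ++ nseq C f' ++ nseq B (- e') ++ nseq C (- f')) ++
    (nseq (A - C)%N (- f') ++ dirs (- - e') (- - f') (drop i.+4 l)).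
  by rewrite /= -{1}(subnK HB) -{1}(subnKC HC) !nseqD -!catA.
move: U; rewrite E => /uniq_no_closed_subwalk; rewrite !big_cat /= !sum_nseq.
rewrite !mulNrn -opprD addrA subrr => /(_ erefl).
by case: B {HB E} => //; case: C C0 {HC}.
Qed.

(* The second and fourth lengths agree, so the fifth segment runs along the line
   of the first one, towards the anchor. *)
Lemma five_segments a e f (l0 l1 l2 l4 : nat) l :
  uniq (pts a (dirs e f [:: l0, l1, l2, l1, l4 & l])) ->
  (0 < l0)%N -> (l0 < l2)%N -> (l0 + l4 < l2)%N.
Proof.
move=> U Hl0 H; rewrite ltnNge; apply/negP => H4.
have H4' : (l2 - l0 <= l4)%N by lia.
have E : dirs e f [:: l0, l1, l2, l1, l4 & l] = [::] ++
    (nseq l0 e ++ nseq l1 f ++ nseq l2 (- e) ++ nseq l1 (- f) ++ nseq (l2 - l0)%N e) ++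
    (nseq (l4 - (l2 - l0))%N e ++ dirs (- - f) (- e) l).
  by rewrite /= -{1}(subnKC H4') !nseqD !opprK -!catA.
move: U; rewrite E => /uniq_no_closed_subwalk.
rewrite !big_cat /= !sum_nseq mulrnBr ?(ltnW H) // !mulNrn => H0.
have /H0 : e *+ l0 + (f *+ l1 + (- (e *+ l2) + (- (f *+ l1) + (e *+ l2 - e *+ l0)))) = 0.
  move: (e *+ l0) (f *+ l1) (e *+ l2) => x y z.
  by rewrite [- z + _]addrCA addKr [- y - x]addrC -opprD addrA subrr.
by case: (l0) Hl0.
Qed.

(** Growth at one position excludes the second alternative of [four_segments] one position earlier,
    so growth spreads all the way to the anchor. *)
Lemma growing_before a e f l j : all (leq 1) l -> uniq (pts a (dirs e f l)) ->
  (j.+2 < size l)%N -> (nth 0 l j <= nth 0 l j.+2)%N ->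
  forall i, (i < j)%N -> (nth 0 l i < nth 0 l i.+2)%N.
Proof.
move=> Hl U; elim: j => // j IH Hj Hjl i.
have H : (nth 0%N l j < nth 0%N l j.+2)%N.
  by have [//|] := four_segments Hl U Hj; rewrite ltnNge Hjl.
rewrite ltnS leq_eqVlt => /orP[/eqP->//|]; apply: IH; by [apply: ltnW|apply: ltnW].
Qed.

End ClosedWalks.

(** * Consequences of the anchor lying on the outer boundary *)

Section Classification.
Local Open Scope ring_scope.

(** Otherwise the ends of the first four segments reach strictly past [a] in all four directions,
    putting [a] inside the bounding box. *)
Lemma outer_boundary_lengths (s : seq pt) (a e f : pt) l : e \in cardinal_dirs ->
  f = rot_ccw e \/ f = rot_cw e -> all (leq 1) l -> s =i pts a (dirs e f l) ->
  on_outer_boundary s a -> (3 < size l)%N ->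
  ~ ((nth 0 l 0 < nth 0 l 2)%N /\ (nth 0 l 1 < nth 0 l 3)%N).
Proof.
case: l => [|l0 [|l1 [|l2 [|l3 l]]]] // He Hf /and5P[h0 h1 _ _ _] Hs Ha _ /= [H02 H13].
have mem u w : dirs e f [:: l0, l1, l2, l3 & l] = u ++ w -> a + \sum_(x <- u) x \in s.
  by move=> E; rewrite Hs E mem_pts_prefix.
have := mem (nseq l0 e) _ erefl.
have := mem (nseq l0 e ++ nseq l1 f) _ (catA _ _ _).
have := mem (nseq l0 e ++ nseq l1 f ++ nseq l2 (- e)) (nseq l3 (- f) ++ dirs (- - e) (- - f) l).
rewrite /= -!catA => /(_ erefl).
have := mem (nseq l0 e ++ nseq l1 f ++ nseq l2 (- e) ++ nseq l3 (- f)) (dirs (- - e) (- - f) l).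
rewrite /= -!catA => /(_ erefl).
rewrite !big_cat /= !sum_nseq {mem Hs}.
move=> m4 m3 m2 m1.
have pmul (p : pt) n : p *+ n = (n%:Z * p.1, n%:Z * p.2).
  elim: n => [|n IH]; first by rewrite !mul0r.
  by rewrite mulrS IH -addn1 PoszD !mulrDl !mul1r addrC.
move: m4 m3 m2 m1; rewrite !pmul.
case: a Ha => a1 a2 Ha m4 m3 m2 m1.
case/or4P: Ha => /allP H; have := H _ m1; have := H _ m2; have := H _ m3; have := H _ m4;
  move: He Hf; rewrite !inE => /or4P[] /eqP -> [] -> /=; lia.
Qed.

Lemma ok_lengths (s : seq pt) (a e f : pt) l : e \in cardinal_dirs ->
  f = rot_ccw e \/ f = rot_cw e -> all (leq 1) l -> l != [::] ->
  uniq (pts a (dirs e f l)) -> s =i pts a (dirs e f l) -> on_outer_boundary s a ->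
  exists e' f' L, [/\ e' \in cardinal_dirs, f' = rot_ccw e' \/ f' = rot_cw e', ok L,
    dirs e' f' L = dirs e f l & (size L <= (size l).+1)%N].
Proof.
move=> He Hf Hl l0 U Hs Ha.
have bd := outer_boundary_lengths He Hf Hl Hs Ha.
have pos k : (k < size l)%N -> (0 < nth 0%N l k)%N by move=> Hk; apply: (all_nthP 0%N Hl).
(* A failure at [i > 1] would spread to positions [0] and [1], against [bd]; near the inner end
   positivity is enough. *)
have dec i : (1 < i < size l)%N -> (nth 0 l i.+2 < nth 0 l i)%N.
  move=> /andP[Hi1 Hi]; have [Hi2|Hi2] := ltnP i.+2 (size l); last first.
    by rewrite nth_default // pos.
  rewrite ltnNge; apply/negP => Hle; have H := growing_before Hl U Hi2 Hle.
  apply: bd; first by lia.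
  by split; apply: H; lia.
have [H3|H3] := ltnP (nth 0%N l 3) (nth 0%N l 1).
  have s1 : (1 < size l)%N by rewrite ltnNge; apply/negP => H; rewrite [nth _ _ 1]nth_default in H3.
  (* An empty segment in front shifts the indices by one: [H3] becomes the first decreasing
     inequality, and also the last condition of [ok], whose first term is now [0]. *)
  exists (- f), e, (0%N :: l); split=> //=.
  - by move: He Hf; rewrite !inE => /or4P[] /eqP -> [] ->.
  - by case: Hf => ->; [left|right]; case: (e) => x y; rewrite /rot_ccw /rot_cw /= ?opprK.
  - split=> //=; [exact: ltnW|by apply: pos; exact: ltnW|].
    by case=> [|[|[|i]]] // Hi; apply: dec.
  - by rewrite opprK.
have [s1|s1] := ltnP 1 (size l); last first.
  exists (- f), e, (0%N :: l); split=> //=.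
  - by move: He Hf; rewrite !inE => /or4P[] /eqP -> [] ->.
  - by case: Hf => ->; [left|right]; case: (e) => x y; rewrite /rot_ccw /rot_cw /= ?opprK.
  - split=> //=; rewrite ?ltnS; try by [case: (l) l0|apply: pos; case: (l) l0].
    by move=> i; lia.
    by lia.
  - by rewrite opprK.
have s3 : (3 < size l)%N.
  by rewrite ltnNge; apply/negP => H; have := pos _ s1;
  rewrite [nth _ _ 3]nth_default in H3 => //; lia.
(* The first length is below the third, so the boundary condition forces the second and fourth to be
   equal, the situation of [five_segments]. *)
have [H0|] := four_segments Hl U s3; last by rewrite ltnNge H3.
have E : nth 0%N l 3 = nth 0%N l 1.
  apply/eqP; rewrite eqn_leq H3 andbT leqNgt; apply/negP => H1; exact: bd.
exists e, f, l; split=> //; split=> //; first exact: pos.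
move=> _; move: U H0 E (pos 0%N (ltnW s1)); case: (l) s3 => [|x0 [|x1 [|x2 [|x3 [|x4 r]]]]] //= _.
  by rewrite addn0.
move=> U H0 E P0; rewrite E in U; exact: five_segments U P0 H0.
Qed.

End Classification.

(** * Segment lengths of a spiral read from its external end *)

Section SpiralLengths.
Local Open Scope ring_scope.

Lemma iotaS m : iota 0 m.+1 = 0%N :: [seq i.+1 | i <- iota 0 m].
Proof. by rewrite /= -(addn0 1%N) iotaDl; congr (_ :: _). Qed.

Lemma mkseq_cons (T : Type) (F : nat -> T) m :
  mkseq F m.+1 = F 0%N :: mkseq (fun i => F i.+1) m.
Proof. by rewrite /mkseq iotaS /= -map_comp. Qed.

(** Since [rot] squares to [-1], the frames of [dirs] follow the iterates of [rot]; each change of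
    [F] opens a new segment. *)
Lemma run_lengths (V : zmodType) (rot : V -> V) (F : nat -> V) m :
  (forall v, rot (rot v) = - v) ->
  (forall i, (i < m)%N -> F i.+1 = F i \/ F i.+1 = rot (F i)) ->
  exists l, [/\ all (leq 1) l, l != [::], mkseq F m.+1 = dirs (F 0%N) (rot (F 0%N)) l &
    (size l <= (count (fun i => F i.+1 != F i) (iota 0 m)).+1)%N].
Proof.
move=> rotK; elim: m F => [|m IH] F H; first by exists [:: 1%N].
have [|l [Hl l0 E Hs]] := IH (fun i => F i.+1).
  by move=> i Hi; apply: (H i.+1).
rewrite iotaS mkseq_cons E /= count_map.
set c := count _ _ in Hs; set c' := count _ _; have {}Hs : (size l <= c'.+1)%N by [].
have [E1|E1] := eqVneq (F 1%N) (F 0%N).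
  case: l Hl l0 {E} Hs => // n l /= /andP[Hn Hl] _ Hs.
  by exists (n.+1 :: l); rewrite /= E1 add0n.
have [|E2] := H 0%N isT; first by move/eqP; rewrite (negPf E1).
by exists (1%N :: l); rewrite /= Hl E2 rotK; split=> //; lia.
Qed.

Lemma adjacent_cardinal (p q : pt) : adjacent p q -> psub q p \in cardinal_dirs.
Proof.
case: p q => [p1 p2] [q1 q2]; rewrite /adjacent /psub /= => H.
have [[]|[[]|[[]|[]]]] : (q1 - p1 = 1 /\ q2 - p2 = 0) \/ (q1 - p1 = -1 /\ q2 - p2 = 0) \/
  (q1 - p1 = 0 /\ q2 - p2 = 1) \/ (q1 - p1 = 0 /\ q2 - p2 = -1) by lia.
all: by move=> -> ->; rewrite !inE eqxx ?orbT.
Qed.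

Lemma cardinal_not_perp (p q : pt) : p \in cardinal_dirs -> q \in cardinal_dirs ->
  ~~ perp p q -> q = p \/ q = - p.
Proof.
by rewrite !inE => /or4P[] /eqP-> /or4P[] /eqP-> //=; auto.
Qed.

Lemma nth_ptsS (V : zmodType) x0 (a : V) v i : (i < size v)%N ->
  nth x0 (pts a v) i.+1 = nth x0 (pts a v) i + nth x0 v i.
Proof.
move=> Hi; rewrite !nth_pts ?(ltnW Hi) // (take_nth x0) // -cats1 big_cat big_seq1 /=.
by rewrite addrA.
Qed.

Lemma grid_path_dirs (s : seq pt) : grid_path s ->
  (forall i, (i.+1 < size s)%N -> pdir s i \in cardinal_dirs) /\
  (forall i, (0 < i)%N -> (i.+1 < size s)%N -> pdir s i != - pdir s i.-1).
Proof.
case: s => // x s' /andP[U /(pathP pt0) Hp]; split.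
  by move=> i Hi; apply: adjacent_cardinal; exact: (Hp i Hi).
move=> [|i] // _ Hi; apply/eqP; rewrite /= /pdir => E.
have : nth pt0 (x :: s') i.+2 = nth pt0 (x :: s') i.
  move: E; case: (nth _ _ i.+2) (nth _ _ i.+1) (nth _ _ i) => [a1 a2] [b1 b2] [c1 c2].
  by rewrite /psub /= => -[E1 E2]; congr (_, _); lia.
move/eqP; rewrite nth_uniq //; first by lia.
by apply: ltnW; apply: ltnW.
Qed.

Lemma spiral_lengths (s : seq pt) : spiral s -> (1 < size s)%N ->
  exists e f l, [/\ e \in cardinal_dirs, f = rot_ccw e \/ f = rot_cw e,
    all (leq 1) l /\ l != [::], rev s = pts (last pt0 s) (dirs e f l) &
    (size l <= (num_turning s).+1)%N].
Proof.
move=> [Hg [rot [Hrot Hturn]]] Hn.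
have [card_s back_s] := grid_path_dirs Hg.
have [m Em] : exists m, size s = m.+2 by exists (size s).-2; lia.
pose F i := - pdir s (m - i).
(* Read backwards, the path turns by the inverse of the quarter turn [rot], which is its
   negative. *)
pose rot' := fun v : pt => - rot v.
have rotK v : rot' (rot' v) = - v.
  by rewrite /rot'; case: Hrot => ->; case: v => x y; rewrite /rot_ccw /rot_cw /= ?opprK.
have stepF j : (j < m)%N -> pdir s j.+1 = pdir s j \/
    (perp (pdir s j) (pdir s j.+1) /\ pdir s j.+1 = rot (pdir s j)).
  move=> Hj; have Hj2 : (j.+2 < size s)%N by rewrite Em.
  case Hp: (perp (pdir s j) (pdir s j.+1)); first by right; split=> //; apply: (Hturn j.+1).
  left; have [//|/eqP] := cardinal_not_perp (card_s _ (ltnW Hj2)) (card_s _ Hj2) (negbT Hp).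
  by rewrite (negPf (back_s j.+1 isT Hj2)).
have FS i : (i < m)%N -> F i = - pdir s (m - i.+1).+1 by move=> Hi; rewrite /F -subSn.
have HF i : (i < m)%N -> F i.+1 = F i \/ F i.+1 = rot' (F i).
  move=> Hi; rewrite (FS i Hi) /F.
  have [->|[_ ->]] := stepF (m - i.+1)%N ltac:(lia); first by left.
  right; rewrite /rot'; case: Hrot => ->; case: (pdir _ _) => x y;
  by rewrite /rot_ccw /rot_cw /= ?opprK.
have [l [Hl l0 E Hs]] := run_lengths rotK HF.
exists (F 0%N), (rot' (F 0%N)), l; split=> //.
- have : pdir s (m - 0) \in cardinal_dirs by apply: card_s; rewrite subn0 Em.
  by rewrite /F !inE => /or4P[] /eqP ->.
- by rewrite /rot'; case: Hrot => ->; [right|left]; case: (F 0%N) => x y;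
    congr (_, _) => /=; rewrite ?opprK.
- rewrite -E; apply: (@eq_from_nth _ pt0).
    by rewrite size_rev size_pts size_mkseq.
  move=> i; rewrite size_rev Em ltnS => Hi; rewrite nth_rev Em // subSS.
  elim: i Hi => [|i IH] Hi; first by rewrite subn0 (last_nth pt0); case: (s) Em => //= x r [->].
  rewrite nth_ptsS ?size_mkseq // -IH 1?ltnW // nth_mkseq // /F /pdir.
  rewrite subSS -subSn //; case: (nth _ s _) (nth _ s _) => [x1 x2] [y1 y2].
  by congr (_, _) => /=; ring.
apply: leq_trans Hs _; rewrite ltnS.
(* The change between steps [i] and [i + 1] of the reversed path takes place at the node of index
   [m - i] in [s]. *)
have : (count (fun i => F i.+1 != F i) (iota 0 m) <=
        count (turning s) [seq (m - i)%N | i <- iota 0 m])%N.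
  rewrite count_map (@eq_in_count _ _ (fun i => (i < m)%N && (F i.+1 != F i))); last first.
    by move=> i; rewrite mem_iota /= => ->.
  apply: sub_count => i /= /andP[Hi]; rewrite (FS i Hi) /F (inj_eq oppr_inj) => Hne.
  have Em' : (m - i = (m - i.+1).+1)%N by lia.
  rewrite /turning Em' /=.
  have [Heq|[-> _]] := stepF (m - i.+1)%N ltac:(lia); last by rewrite orbT.
  by rewrite Heq eqxx in Hne.
move/leq_trans; apply; rewrite /num_turning -!size_filter; apply: uniq_leq_size.
  rewrite filter_uniq // map_inj_in_uniq ?iota_uniq // => i j.
  by rewrite !mem_iota; lia.
move=> x; rewrite !mem_filter => /andP[-> /mapP[i]].
by rewrite !mem_iota Em => Hi ->; lia.
Qed.
End SpiralLengths.

(** * The logarithmic bound *)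

Lemma path_shape_rev (s : seq pt) : s != [::] -> path_shape (rev s) = path_shape s.
Proof.
move=> s0; have r0 : rev s != [::] by rewrite -size_eq0 size_rev size_eq0.
rewrite !path_shapeE // size_rev pshape_rev; apply: eq_pshape => i Hi.
have n0 : 0 < size s by rewrite lt0n size_eq0.
by rewrite nth_rev; [congr nth|]; lia.
Qed.

Local Open Scope fset_scope.

(* P is the spiral s listed from tp_1 (head, internal) to tp_k (last,
   external); n = size s, k = num_turning s.  "k = O(log n)" and
   "O(log n) time steps" are read with explicit constants c and C. *)
Theorem theorem3p3 :
  forall c : nat, exists C : nat,
  forall s : seq pt,
    spiral s ->
    on_outer_boundary s (last pt0 s) ->
    (num_turning s <= c * (trunc_log 2 (size s)).+1)%N ->
    exists t : nat, (t <= C * (trunc_log 2 (size s)).+1)%N /\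
      grows (last pt0 s) t (Shape [fset last pt0 s] fset0) (path_shape s).
Proof.
(* With [K] the logarithmic factor there are at most [c K + 2] segments, hence at most
   [2 + 3 (c K + 2) + 2 K] steps; [K >= 1] absorbs the constant [8]. *)
move=> c; exists (3 * c + 10)%N => s Hsp Hb Hk.
have [Hg _] := Hsp; have s0 : s != [::] by case: (s) Hg.
suff [t Ht G] : exists2 t, (t <= (3 * c + 10) * (trunc_log 2 (size s)).+1)%N &
    grows (last pt0 s) t (Shape [fset last pt0 s] fset0) (path_shape (rev s)).
  by exists t; rewrite -path_shape_rev.
have [n1|n1] := ltnP 1 (size s); last first.
  case: (s) s0 n1 => [|a [|b r]] // _ _.
  by have [t Ht G] := grown_nil a; exists t => //; apply: leq_trans Ht _.
have [e [f [l [He Hf [Hl l0] E Hs]]]] := spiral_lengths Hsp n1.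
have U : uniq (pts (last pt0 s) (dirs e f l)).
  by rewrite -E rev_uniq; case: (s) Hg => // x r /andP[].
have Hmem : s =i pts (last pt0 s) (dirs e f l) by move=> x; rewrite -E mem_rev.
have [e' [f' [L [He' Hf' okL EL HsL]]]] := ok_lengths He Hf Hl l0 U Hmem Hb.
(* No segment is longer than the whole path, so [K] stages suffice. *)
have HL i : (nth 0 L i < 2 ^ (trunc_log 2 (size s)).+1)%N.
  apply: leq_ltn_trans (trunc_log_ltn (size s) (isT : (1 < 2)%N)).
  have -> : size s = (sumn L).+1.
    by rewrite -(size_dirs e' f') EL -(size_pts (last pt0 s)) -E size_rev.
  elim: (L) i => [|x r IH] [|i] //=; first by rewrite ltnW // ltnS leq_addr.
  by apply: leq_trans (IH i) _; rewrite ltnS leq_addl.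
have [t Ht G] := grown_ok (last pt0 s) He' Hf' okL HL.
rewrite EL -E in G; exists t => //; apply: leq_trans Ht _.
move: (trunc_log 2 (size s)).+1 (ltn0Sn (trunc_log 2 (size s))) Hk => K K0 Hk.
by rewrite mulnDl -mulnA; lia.
Qed.
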